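(* Let $q$ be a prime power, $n\geq 4$ an integer, $m$ a positive divisor of $q^n-1$, and $\beta\in\mathbb{F}_{q^n}$ an element that is $2$-normal over $\mathbb{F}_q$ and such that $\beta\notin\mathbb{F}_{q^d}$ for every divisor $d<n$ of $n$. Let $N_\beta(m)$ be the number of elements $a\in\mathbb{F}_q$ such that $a+\beta$ is $m$-free. If $q^{1/2}\geq (n-1)W(m)$, then $N_\beta(m)>0$.
   Context: For $\alpha\in\mathbb{F}_{q^n}$ let $g_\alpha(x)=\sum_{i=0}^{n-1}\alpha^{q^i}x^{n-1-i}$; $\alpha$ is $k$-normal over $\mathbb{F}_q$ if $\gcd(x^n-1,g_\alpha(x))$ in $\mathbb{F}_{q^n}[x]$ has degree $k$. For $m\mid q^n-1$, an element $\gamma\in\mathbb{F}_{q^n}^*$ is $m$-free if $\gamma=\eta^d$ with $\eta\in\mathbb{F}_{q^n}$ and $d$ a positive divisor of $m$ implies $d=1$. $W(m)$ is the number of square-free positive divisors of $m$. *)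

(* Defs.v *)
From HB Require Import structures.
From mathcomp Require Import all_boot all_order all_algebra all_field.
Set Implicit Arguments. Unset Strict Implicit. Unset Printing Implicit Defensive.
Import GRing.Theory.
Local Open Scope ring_scope.

(* The field L plays the role of F_{q^n}; F_q is its subfield {a | a^q = a}. *)

Definition g_poly (L : fieldType) (q n : nat) (alpha : L) : {poly L} :=
  \sum_(i < n) (alpha ^+ (q ^ i))%:P * 'X^(n.-1 - i).

Definition k_normal (L : fieldType) (q n k : nat) (alpha : L) : bool :=
  (size (gcdp ('X^n - 1) (g_poly q n alpha))).-1 == k.

Definition m_free (L : finFieldType) (m : nat) (gamma : L) : bool :=
  (gamma != 0) &&
  [forall d : 'I_m.+1, forall eta : L,
     ((0 < d)%N && (d %| m)%N && (gamma == eta ^+ d)) ==> (d == 1%N :> nat)].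

Definition squarefree (d : nat) : bool :=
  all (fun p => logn p d <= 1)%N (primes d).

Definition W (m : nat) : nat := count squarefree (divisors m).

Definition N_beta (L : finFieldType) (q : nat) (beta : L) (m : nat) : nat :=
  #|[set a : L | (a ^+ q == a) && m_free m (a + beta)]|.

(* Main.v *)
Require Import Defs.
From HB Require Import structures.
From mathcomp Require Import all_boot all_order all_algebra all_field.
From mathcomp Require Import cyclic zify ring.
Set Implicit Arguments. Unset Strict Implicit. Unset Printing Implicit Defensive.
Import Order.TTheory GRing.Theory Num.Theory.
Local Open Scope ring_scope.

(** The number of [a] in F_q with [a + beta] m-free is a combination of the sums
    S(chi) = sum_(a in F_q) chi(a + beta) over multiplicative characters chi of
    F_(q^n); removing the l-th powers for one prime l | m after the other costs
    a factor 2 each time, whence W(m), so everything rests on Katz's bound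
    |S(chi)| <= (n - 1) sqrt q for nontrivial chi.

    Since beta generates F_(q^n), the sums of chi(f(beta)) over monic f of
    degree k over F_q vanish for k >= n.  They are therefore the coefficients of
    a polynomial prod (1 - w T) with at most n - 1 inverse roots w, where S(chi)
    is minus the sum of the w.  Counting the orbit polynomials
    prod_(j < r) (X - a^(q^j)), a in F_(q^r), that divide f shows that the power
    sums of the w are, up to sign, the analogous sums S_r over F_(q^r).

    For r divisible by 2n the number of a in F_(q^r) at which the argument of
    chi takes a given value c is bounded by Stepanov's auxiliary polynomial
    method, giving S_r = O(q^(r/2)) with a constant independent of r.  This
    forces |w| <= sqrt q, however bad the constant is. *)

(** A homogeneous system with more unknowns than equations has a non-zero solution; this yields the
    coefficients of Stepanov's polynomial. *)
Lemma exists_nontrivial_relation (F : fieldType) (I J : finType)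
    (a : I -> J -> F) :
  (#|J| < #|I|)%N ->
  exists v : I -> F, (exists i, v i != 0) /\ forall j, \sum_i v i * a i j = 0.
Proof.
move=> ltJI.
pose A : 'M[F]_(#|I|, #|J|) := \matrix_(i, j) a (enum_val i) (enum_val j).
have nzK : kermx A != 0.
  rewrite kermx_eq0 -row_leq_rank -ltnNge.
  exact: leq_ltn_trans (rank_leq_col A) _.
pose w := nz_row (kermx A).
have wA : w *m A = 0 by apply/sub_kermxP; exact: nz_row_sub.
exists (fun i => w 0 (enum_rank i)); split.
  have : w != 0 by rewrite nz_row_eq0.
  by case/rV0Pn => i nzi; exists (enum_val i); rewrite enum_valK.
move=> j; have := congr1 (fun B : 'rV_ _ => B 0 (enum_rank j)) wA.
rewrite [LHS]mxE [RHS]mxE => wA0; rewrite -[RHS]wA0 [RHS](reindex enum_rank) /=; last first.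
  by apply: onW_bij; exists enum_val; [exact: enum_rankK | exact: enum_valK].
by apply: eq_bigr => i _; rewrite [A _ _]mxE !enum_rankK.
Qed.

(** * Stepanov's method *)

Section InnerDegree.
Variable F : fieldType.
Implicit Types G H : {poly {poly F}}.

(** The outer variable is the displacement y, and the coefficients are polynomials in the base point
    x; only the degree in x is controlled. *)
Definition inner_degree_le G (a : nat) := forall l, (size (G`_l)%R <= a.+1)%N.

Lemma inner_degree_le_trans G a b :
  inner_degree_le G a -> (a <= b)%N -> inner_degree_le G b.
Proof. by move=> Ga leab l; apply: leq_trans (Ga l) _. Qed.

Lemma inner_degree_leC (p : {poly F}) a :
  (size p <= a.+1)%N -> inner_degree_le p%:P a.
Proof. by move=> sp l; rewrite coefC; case: eqP => //; rewrite size_poly0. Qed.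

Lemma inner_degree_leX : inner_degree_le 'X 0.
Proof. by move=> l; rewrite coefX; case: eqP; rewrite ?size_poly1 ?size_poly0. Qed.

Lemma inner_degree_leD G H a :
  inner_degree_le G a -> inner_degree_le H a -> inner_degree_le (G + H) a.
Proof.
move=> Ga Ha l; rewrite coefD; apply: leq_trans (size_polyD _ _) _.
by rewrite geq_max Ga Ha.
Qed.

Lemma inner_degree_le_sum (I : Type) (r : seq I) (P : pred I) (G : I -> _) a :
  (forall i, P i -> inner_degree_le (G i) a) ->
  inner_degree_le (\sum_(i <- r | P i) G i) a.
Proof.
move=> Ga; elim/big_rec: _ => [l|i H Pi Ha]; first by rewrite coef0 size_poly0.
exact: inner_degree_leD (Ga i Pi) Ha.
Qed.

Lemma inner_degree_leM G H a b :
  inner_degree_le G a -> inner_degree_le H b -> inner_degree_le (G * H) (a + b).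
Proof.
move=> Ga Hb l; rewrite coefM; apply: leq_trans (size_sum _ _ _) _.
apply/bigmax_leqP => i _; apply: leq_trans (size_polyMleq _ _) _.
by have := Ga i; have := Hb (l - i)%N; lia.
Qed.

Lemma inner_degree_leXn G a k :
  inner_degree_le G a -> inner_degree_le (G ^+ k) (k * a).
Proof.
move=> Ga; elim: k => [|k IHk]; first by apply: inner_degree_leC; rewrite size_poly1.
by rewrite exprS mulSn; apply: inner_degree_leM.
Qed.

Lemma inner_degree_leMn G a k :
  inner_degree_le G a -> inner_degree_le (G *+ k) a.
Proof.
move=> Ga; elim: k => [|k IHk]; first by move=> l; rewrite mulr0n coef0 size_poly0.
by rewrite mulrS; apply: inner_degree_leD.
Qed.

(** This is p(x + y); setting x = a with [inner_eval a] gives the Taylor expansion of p around a. *)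
Definition biv_shift (p : {poly F}) : {poly {poly F}} := p^:P \Po ('X + 'X%:P).

Lemma biv_shift_degree (p : {poly F}) a :
  (size p <= a.+1)%N -> inner_degree_le (biv_shift p) a.
Proof.
move=> sp; rewrite /biv_shift comp_polyE; apply: inner_degree_le_sum => i _.
rewrite -mul_polyC coef_map /=.
have -> : a = (0 + a)%N by [].
apply: inner_degree_leM.
  by apply: inner_degree_leC; rewrite size_polyC; case: eqP.
apply: (@inner_degree_le_trans _ (i * 1)); last first.
  by rewrite muln1 -ltnS (leq_trans (ltn_ord i)) // size_map_polyC.
apply: inner_degree_leXn; apply: inner_degree_leD.
  exact: inner_degree_le_trans inner_degree_leX _.
by apply: inner_degree_leC; rewrite size_polyX.
Qed.

Lemma biv_shift_coef0 p : (biv_shift p)`_0 = p.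
Proof.
rewrite -horner_coef0 /biv_shift horner_comp !hornerE.
by rewrite -[RHS]comp_polyXr.
Qed.

Definition inner_eval (a : F) : {poly {poly F}} -> {poly F} :=
  map_poly (horner_eval a).
HB.instance Definition _ a := GRing.RMorphism.on (inner_eval a).

Lemma inner_evalC a q : inner_eval a q%:P = q.[a]%:P.
Proof. exact: map_polyC. Qed.

Lemma inner_evalCM a q G : inner_eval a (q%:P * G) = q.[a]%:P * inner_eval a G.
Proof. by rewrite rmorphM /= inner_evalC. Qed.

Lemma inner_eval_shift a p : inner_eval a (biv_shift p) = p \Po ('X + a%:P).
Proof.
rewrite /inner_eval /biv_shift map_comp_poly rmorphD /= map_polyX map_polyC /=.
congr (_ \Po _); first by rewrite /horner_eval hornerX.
by apply/polyP => i; rewrite !coef_map /= /horner_eval hornerC.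
Qed.

End InnerDegree.

Lemma prod_XsubC_exp_dvdp (F : fieldType) (A : seq F) (M : nat) (R : {poly F}) :
  uniq A -> (forall a, a \in A -> ('X - a%:P) ^+ M %| R) ->
  (\prod_(a <- A) ('X - a%:P)) ^+ M %| R.
Proof.
elim: A => [|a A IHA] /=; first by rewrite big_nil expr1n dvd1p.
case/andP=> nAa uA dvdR; rewrite big_cons exprMn Gauss_dvdp.
  by rewrite dvdR ?mem_head // IHA // => b bA; rewrite dvdR // in_cons bA orbT.
rewrite coprimep_expl // coprimep_expr // coprimep_sym coprimep_XsubC.
by rewrite root_prod_XsubC.
Qed.

Section Stepanov.
Variables (F : fieldType) (p : nat).
Hypothesis charFp : p \in [pchar F].

Lemma modXn_mul (M : nat) (f g f' g' : {poly F}) :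
  'X^M %| f - f' -> 'X^M %| g - g' -> 'X^M %| f * g - f' * g'.
Proof.
move=> df dg.
have -> : f * g - f' * g' = (f - f') * g + f' * (g - g') by ring.
by apply: dvdp_add; [exact: dvdp_mulr | exact: dvdp_mull].
Qed.

Lemma modXn_exp_cst (M Q i : nat) (c : F) :
  (M <= Q)%N -> 'X^M %| ('X^Q + c%:P) ^+ i - (c ^+ i)%:P.
Proof.
move=> leMQ; elim: i => [|i IHi]; first by rewrite !expr0 subrr dvdp0.
by rewrite !exprS polyCM modXn_mul // addrK dvdp_exp2l.
Qed.

(* The expansion of [f(x + y)^(M + e)] in powers of [y], cut off at [y^M] and
   divided by [f(x)^e]. *)
Definition trunc_power (f : {poly F}) (M e : nat) : {poly {poly F}} :=
  \sum_(s < M) ((f ^+ (M - s))%:P * ('X * drop_poly 1 (biv_shift f)) ^+ s)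
     *+ 'C(M + e, s).

Lemma trunc_power_degree (f : {poly F}) (M e D : nat) :
  (size f <= D.+1)%N -> inner_degree_le (trunc_power f M e) (M * D).
Proof.
move=> sf; apply: inner_degree_le_sum => s _; apply: inner_degree_leMn.
have -> : (M * D = (M - s) * D + s * (0 + D))%N.
  by rewrite -mulnDl subnK // ltnW.
apply: inner_degree_leM.
  rewrite polyC_exp; apply: inner_degree_leXn; exact: inner_degree_leC.
apply: inner_degree_leXn; apply: inner_degree_leM; first exact: inner_degree_leX.
by move=> l; rewrite coef_drop_poly; apply: biv_shift_degree.
Qed.

Lemma biv_shift_split (f : {poly F}) :
  biv_shift f = f%:P + 'X * drop_poly 1 (biv_shift f).
Proof.
rewrite -[LHS](poly_take_drop 1) expr1 mulrC; congr (_ + _).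
apply/polyP => i; rewrite coef_take_poly coefC.
by case: i => [|i] //=; rewrite biv_shift_coef0.
Qed.

(** Write f(X + a) = f(a) + X g and expand. The terms of index s >= M are multiples of X^M; in the
    others f(a) has exponent M + e - s, so f(a)^e factors out. *)
Lemma inner_eval_trunc_power (f : {poly F}) (M e : nat) (a : F) :
  'X^M %| (f ^+ (M + e)) \Po ('X + a%:P)
          - (f.[a] ^+ e)%:P * inner_eval a (trunc_power f M e).
Proof.
pose g := inner_eval a (drop_poly 1 (biv_shift f)).
have fE : f \Po ('X + a%:P) = f.[a]%:P + 'X * g.
  rewrite -inner_eval_shift {1}biv_shift_split rmorphD rmorphM /=.
  by rewrite inner_evalC /inner_eval map_polyX.
rewrite rmorphXn /= fE exprDn.
rewrite -(big_mkord xpredT (fun i => f.[a]%:P ^+ (M + e - i) * ('X * g) ^+ i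
                                      *+ 'C(M + e, i))).
rewrite (big_cat_nat (n := M)) //=; last by rewrite -addnS leq_addr.
rewrite big_mkord addrAC dvdp_add //; last first.
  rewrite big_nat; apply: (big_ind (fun h => 'X^M %| h)) => [|*|i /andP[leMi _]].
  - exact: dvdp0.
  - exact: dvdp_add.
  by rewrite -mulr_natr dvdp_mulr // dvdp_mull // exprMn dvdp_mulr // dvdp_exp2l.
rewrite /trunc_power rmorph_sum /= mulr_sumr.
rewrite (eq_bigr (fun i : 'I_M => (f.[a] ^+ e)%:P *
   inner_eval a (((f ^+ (M - i))%:P * ('X * drop_poly 1 (biv_shift f)) ^+ i)
     *+ 'C(M + e, i)))) ?subrr ?dvdp0 // => i _.
rewrite rmorphMn rmorphM /= !rmorphXn /= rmorphM /=.
rewrite inner_evalC {1}/inner_eval map_polyX -/g.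
rewrite mulrnAr mulrA -exprD; congr (_ ^+ _ * _ *+ _).
by have := ltn_ord i; lia.
Qed.

Section AuxiliaryPolynomial.
Variables (Q d u I M D : nat) (f h : {poly F}) (c : F).
Hypotheses (pQ : p.-nat Q) (QE : Q = (d * u).+1) (d_gt0 : (0 < d)%N).
Hypotheses (leMQ : (M <= Q)%N) (fE : f = 'X * h) (h0 : h.[0] != 0).
Hypotheses (sf : (size f <= D.+1)%N).
Hypothesis dimension_count : (M * (I + u + M * D) < d * I * u)%N.

Let idx : finType := ('I_(d * I) * 'I_u)%type.

Let term (t : idx) : {poly F} :=
  f ^+ (M + u * (t.1 %% d)) * 'X^(t.2) * ('X^Q) ^+ (t.1 %/ d).

(* At a point [a] with [a ^ Q = a] and [f(a) ^ u = c], the expansion of [term t]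
   around [a] is, modulo [X ^ M], this polynomial in [x] and [y] at [x = a];
   its degree in [x] does not involve [Q]. *)
Let biv_term (t : idx) : {poly {poly F}} :=
  (c ^+ (t.1 %% d))%:P%:P * trunc_power f M (u * (t.1 %% d)) *
  biv_shift ('X^(t.2)) * ('X^(t.1 %/ d))%:P.

Let XaQ (a : F) : a ^+ Q = a -> ('X + a%:P) ^+ Q = 'X^Q + a%:P.
Proof.
move=> aQ; rewrite exprDn_pchar.
  by rewrite -polyC_exp aQ.
rewrite (eq_pnat _ (pcharf_eq (_ : p \in [pchar {poly F}]))) //.
by rewrite pchar_poly.
Qed.

(** The shift by a turns X^Q into X^Q + a, which is a modulo X^M since M <= Q, and f(a)^(u j) equals
    c^j. The factors whose degree grows with Q thus leave only a^i and c^j behind. *)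
Let term_mod (t : idx) (a : F) :
  a ^+ Q = a -> f.[a] ^+ u = c ->
  'X^M %| term t \Po ('X + a%:P) - inner_eval a (biv_term t).
Proof.
move=> aQ fau; rewrite /term /biv_term !comp_polyM !rmorphM /=.
apply: modXn_mul; last first.
  rewrite !rmorphXn /= comp_polyX XaQ // inner_evalC.
  rewrite hornerX -polyC_exp; exact: modXn_exp_cst.
apply: modXn_mul; last by rewrite inner_eval_shift subrr dvdp0.
rewrite inner_evalC hornerC -fau -exprM.
exact: inner_eval_trunc_power.
Qed.

Let biv_term_degree (t : idx) :
  inner_degree_le (biv_term t) (I + u + M * D).-1.
Proof.
have [ltN ltb] := (ltn_ord t.1, ltn_ord t.2).
have lti : (t.1 %/ d < I)%N by rewrite ltn_divLR // [(I * d)%N]mulnC.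
apply: (@inner_degree_le_trans _ _ (0 + M * D + t.2 + t.1 %/ d)); last by lia.
apply: inner_degree_leM; last by apply: inner_degree_leC; rewrite size_polyXn.
apply: inner_degree_leM; last by apply: biv_shift_degree; rewrite size_polyXn.
apply: inner_degree_leM; last exact: trunc_power_degree.
by apply: inner_degree_leC; rewrite size_polyC; case: eqP.
Qed.

(* The [N]-th block vanishes at [0] to an order lying in
   [[u N + N %/ d, u (N + 1) + N %/ d)]: these intervals are disjoint, so no
   cancellation is possible at the lowest order. *)
Let term_indep (v : idx -> F) (t0 : idx) : v t0 != 0 -> \sum_t v t *: term t != 0.
Proof.
move=> nzt0.
pose k (N : 'I_(d * I)) : {poly F} := \sum_(b < u) v (N, b) *: 'X^b.
pose e (N : 'I_(d * I)) := (u * N + N %/ d)%N.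
have sumE : \sum_t v t *: term t =
    f ^+ M * \sum_N 'X^(e N) * (h ^+ (u * (N %% d)) * k N).
  rewrite (eq_bigr (fun t => v (t.1, t.2) *: term (t.1, t.2))); last by case.
  rewrite -(pair_bigA _ (fun N b => v (N, b) *: term (N, b))) mulr_sumr /=.
  apply: eq_bigr => N _; rewrite /k !mulr_sumr; apply: eq_bigr => b _.
  rewrite /term /= exprD {2}fE exprMn -!exprM -!scalerAr; congr (_ *: _).
  (* With N = d i + j, the power of X is u j + (d u + 1) i = u N + i. *)
  have -> : e N = (u * (N %% d) + Q * (N %/ d))%N.
    by rewrite /e QE {1}(divn_eq N d); lia.
  rewrite exprD; ring.
have h_neq0 : h != 0 by apply: contraNneq h0 => ->; rewrite horner0.
have f_neq0 : f != 0 by rewrite fE mulf_neq0 // polyX_eq0.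
rewrite sumE mulf_neq0 ?expf_neq0 //; apply/negP => /eqP sum0.
have nzk0 : k t0.1 != 0.
  apply: contraNneq nzt0 => k0.
  have <- : (k t0.1)`_(t0.2) = v t0; last by rewrite k0 coef0.
  rewrite /k coef_sum (bigD1 t0.2) //= coefZ coefXn eqxx mulr1 big1 ?addr0.
    by case: (t0).
  move=> b neb; rewrite coefZ coefXn eq_sym; have /negPf := neb.
  by rewrite -val_eqE /= => ->; rewrite mulr0.
have [N nzk minN] := @arg_minnP _ t0.1 (fun N => k N != 0) (fun N => N : nat) nzk0.
have : 'X^(e N + u) %| 'X^(e N) * (h ^+ (u * (N %% d)) * k N).
  move/eqP: sum0; rewrite (bigD1 N) //= addr_eq0 => /eqP ->.
  rewrite dvdpNr; apply: (big_ind (fun h => 'X^(e N + u) %| h)) => [|*|N' neN].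
  - exact: dvdp0.
  - exact: dvdp_add.
  have [->|nzk'] := eqVneq (k N') 0; first by rewrite !mulr0 dvdp0.
  rewrite dvdp_mulr // dvdp_exp2l // /e.
  have ltN : (N < N')%N by rewrite ltn_neqAle eq_sym neN minN.
  rewrite addnAC -mulnSr leq_add ?leq_mul2l ?ltN ?orbT //.
  exact: leq_div2r (ltnW ltN).
rewrite exprD dvdp_mul2l ?expf_neq0 ?polyX_eq0 //.
(* Since h does not vanish at 0, X^u would divide the non-zero [k N], whose degree is below u. *)
rewrite Gauss_dvdpr; last first.
  by rewrite coprimep_expl // coprimep_expr // coprimep_sym coprimepX.
move=> /(dvdp_leq nzk); rewrite size_polyXn ltnNge.
rewrite (leq_trans (size_sum _ _ _)) //; apply/bigmax_leqP => b _.
by rewrite (leq_trans (size_scale_leq _ _)) // size_polyXn.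
Qed.

(** The d I u unknowns are the coefficients of the terms. Making the coefficients of y^0, ...,
    y^(M-1) vanish identically in x costs M (I + u + M D) equations, and gives vanishing to order M
    at all the points a at once. *)
Lemma stepanov_polynomial :
  exists R : {poly F}, [/\ R != 0,
    (size R <= M * D + u + Q * D + I * Q)%N &
    forall a, a ^+ Q = a -> f.[a] ^+ u = c -> ('X - a%:P) ^+ M %| R].
Proof.
pose T := (I + u + M * D)%N.
have T_gt0 : (0 < T)%N by move: dimension_count; rewrite /T; nia.
have [|v [[t0 nzt0] vrel]] := @exists_nontrivial_relation F idx ('I_M * 'I_T)%type
    (fun t s => (biv_term t)`_(s.1)`_(s.2)).
  by rewrite !card_prod !card_ord.
exists (\sum_t v t *: term t); split.
- exact: term_indep nzt0.
- apply: leq_trans (size_sum _ _ _) _; apply/bigmax_leqP => t _.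
  apply: leq_trans (size_scale_leq _ _) _; rewrite /term -exprM.
  have [ltN ltb] := (ltn_ord t.1, ltn_ord t.2).
  have lti : (t.1 %/ d < I)%N by rewrite ltn_divLR // [(I * d)%N]mulnC.
  have ltj := ltn_pmod t.1 d_gt0.
  set e := (M + u * (t.1 %% d))%N.
  have := size_polyMleq (f ^+ e * 'X^(t.2)) 'X^(Q * (t.1 %/ d)).
  have := size_polyMleq (f ^+ e) 'X^(t.2).
  have : (size (f ^+ e) <= e * D + 1)%N.
    apply: leq_trans (size_poly_exp_leq _ _) _; rewrite addn1 ltnS mulnC leq_mul2l.
    by rewrite -subn1 leq_subLR sf orbT.
  have : (e * D <= M * D + Q * D)%N.
    by rewrite /e -mulnDl leq_mul2r leq_add2l QE; apply/orP; right; nia.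
  have : (Q * (t.1 %/ d) + Q <= I * Q)%N by nia.
  by rewrite !size_polyXn; lia.
move=> a aQ fau.
suff: 'X^M %| (\sum_t v t *: term t) \Po ('X + a%:P).
  move=> /(dvdp_comp_poly ('X - a%:P)); rewrite -comp_polyA comp_polyD comp_polyX.
  by rewrite comp_polyC subrK comp_polyXr rmorphXn /= comp_polyX.
have -> : (\sum_t v t *: term t) \Po ('X + a%:P) =
  \sum_t v t *: (term t \Po ('X + a%:P) - inner_eval a (biv_term t))
  + inner_eval a (\sum_t (v t)%:P%:P * biv_term t).
  rewrite [LHS]rmorph_sum rmorph_sum -big_split /=; apply: eq_bigr => t _.
  rewrite comp_polyZ scalerBr (inner_evalCM a (v t)%:P).
  by rewrite hornerC mul_polyC subrK.
apply: dvdp_add.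
  apply: (big_ind (fun h => 'X^M %| h)) => [|*|t _]; [exact: dvdp0|exact: dvdp_add|].
  by rewrite -mul_polyC dvdp_mull // term_mod.
set G := \sum_t _.
have GT : inner_degree_le G T.-1.
  apply: inner_degree_le_sum => t _; rewrite -[T.-1]add0n.
  apply: inner_degree_leM; last exact: biv_term_degree.
  by apply: inner_degree_leC; rewrite size_polyC; case: eqP.
have G0 l : (l < M)%N -> G`_l = 0.
  move=> ltlM; apply/polyP => k; rewrite coef0.
  case: (ltnP k T) => [ltkT | leTk]; last first.
    by rewrite nth_default // (leq_trans (GT l)) // prednK.
  rewrite -[RHS](vrel (Ordinal ltlM, Ordinal ltkT)) /= coef_sum coef_sum.
  by apply: eq_bigr => t _; rewrite !coefCM.
rewrite -[inner_eval a G](poly_take_drop M) dvdp_add ?dvdp_mull //.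
suff -> : take_poly M (inner_eval a G) = 0 by rewrite dvdp0.
apply/polyP => l; rewrite coef_take_poly coef0; case: ifP => // ltlM.
by rewrite coef_map G0 // /= rmorph0.
Qed.
End AuxiliaryPolynomial.

(** The factor of sqrt Q in the error term. It does not involve Q, so the bound is uniform over the
    extensions. *)
Definition stepanov_const (d D : nat) : nat :=
  (d * D + D + 2 * d * (1 + d * D) + 1)%N.

Lemma stepanov_bound (Q q0 d u D : nat) (f h : {poly F}) (c : F) (A : seq F) :
  p.-nat Q -> Q = (q0 ^ 2)%N -> Q = (d * u).+1 -> (0 < d)%N ->
  (2 * d + 2 <= q0)%N -> f = 'X * h -> h.[0] != 0 -> (size f <= D.+1)%N ->
  uniq A -> (forall a, a \in A -> a ^+ Q = a /\ f.[a] ^+ u = c) ->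
  (d * size A <= Q + stepanov_const d D * q0)%N.
Proof.
move=> pQ Qq QE d_gt0 q0_big fE h0 sf uA AP.
(* M and I make the leading terms d q0 u of both sides of the dimension count cancel. The surplus
   [c'] in I then contributes d c' u, about twice the remaining d Q (1 + d D). *)
pose c' := (2 * d * (1 + d * D))%N; pose M := (d * q0)%N; pose I := (q0 + c')%N.
have leMQ : (M <= Q)%N by rewrite /M Qq; nia.
have dimension_count : (M * (I + u + M * D) < d * I * u)%N.
  have big_u : (Q * (1 + d * D) + c' * q0 < c' * u)%N.
    rewrite -(ltn_pmul2l d_gt0); set e := (1 + d * D)%N.
    have -> : (d * (Q * e + c' * q0) = d * e * (Q + 2 * d * q0))%N.
      by rewrite /c' -/e; ring.
    have -> : (d * (c' * u) = d * e * (2 * (d * u)))%N by rewrite /c' -/e; ring.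
    rewrite ltn_pmul2l ?muln_gt0 ?d_gt0 //.
    have : (2 * d * q0 + 2 < Q)%N by rewrite Qq; nia.
    by lia.
  have -> : (M * (I + u + M * D) = d * q0 * u + d * (Q * (1 + d * D) + c' * q0))%N.
    by rewrite /M /I Qq; ring.
  have -> : (d * I * u = d * q0 * u + d * (c' * u))%N by rewrite /I; ring.
  by rewrite ltn_add2l ltn_pmul2l.
have [R [nzR sR vanR]] := stepanov_polynomial c pQ QE d_gt0 leMQ fE h0 sf dimension_count.
have dvdR : (\prod_(a <- A) ('X - a%:P)) ^+ M %| R.
  by apply: prod_XsubC_exp_dvdp => // a /AP[]; apply: vanR.
have leA : (size A * M < M * D + u + Q * D + I * Q)%N.
  have := size_exp (\prod_(a <- A) ('X - a%:P)) M; rewrite size_prod_XsubC /= => <-.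
  apply: leq_trans sR; apply: leq_trans (dvdp_leq nzR dvdR); rewrite prednK //.
  by rewrite size_poly_gt0 expf_neq0 // monic_neq0 // monic_prod_XsubC.
have q0_gt0 : (0 < q0)%N by lia.
rewrite -(leq_pmul2l q0_gt0).
have leu : (u <= q0 * q0)%N by move: QE; rewrite Qq; nia.
have : (q0 * (d * size A) <= M * D + u + Q * D + I * Q)%N.
  by apply: leq_trans (ltnW leA); rewrite /M; nia.
move/leq_trans; apply; rewrite /M /I /stepanov_const -/c' Qq.
have -> : (q0 * (q0 ^ 2 + (d * D + D + c' + 1) * q0) =
  d * D * q0 ^ 2 + q0 * q0 + q0 ^ 2 * D + (q0 + c') * q0 ^ 2)%N by ring.
have : (d * q0 * D <= d * D * q0 ^ 2)%N by nia.
by lia.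
Qed.
End Stepanov.

(** * Inverse roots and their power sums *)

Section InverseRoots.
Variable K : closedFieldType.
Implicit Types (s : seq K) (P : {poly K}).

Lemma factor_inverse_roots P : P.[0] = 1 ->
  exists2 s : seq K, P = \prod_(w <- s) (1 - w *: 'X) & size s = (size P).-1.
Proof.
move=> P0; have [r PE] := closed_field_poly_normal P.
have nzr z : z \in r -> z != 0.
  move=> zr; apply/eqP => z0; suff: P.[0] = 0 by rewrite P0; move/eqP; rewrite oner_eq0.
  apply/rootP; rewrite PE -z0 rootZ ?root_prod_XsubC // lead_coef_eq0.
  by apply: contraPneq P0 => ->; rewrite horner0 => /eqP; rewrite eq_sym oner_eq0.
exists [seq z^-1 | z <- r]; last first.
  rewrite size_map PE size_scale ?size_prod_XsubC // lead_coef_eq0.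
  by apply: contraPneq P0 => ->; rewrite horner0 => /eqP; rewrite eq_sym oner_eq0.
have prodE : \prod_(w <- [seq z^-1 | z <- r]) (1 - w *: 'X)
    = (\prod_(z <- r) - z^-1) *: \prod_(z <- r) ('X - z%:P).
  rewrite big_map; elim: r nzr {PE} => [|z r IHr] nzr; first by rewrite !big_nil scale1r.
  rewrite !big_cons IHr; last by move=> x xr; apply: nzr; rewrite in_cons xr orbT.
  have -> : 1 - z^-1 *: 'X = (- z^-1) *: ('X - z%:P).
    rewrite -[RHS]mul_polyC mulrBr -polyCM mulNr mulVf ?nzr ?mem_head // mul_polyC.
    by rewrite scaleNr polyCN opprK addrC.
  by rewrite -scalerAl -scalerAr scalerA.
have nzc : \prod_(z <- r) - z^-1 != 0.
  by rewrite prodf_seq_neq0; apply/allP => z zr /=; rewrite oppr_eq0 invr_eq0 nzr.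
have PE' : P = (lead_coef P / \prod_(z <- r) - z^-1) *:
               \prod_(w <- [seq z^-1 | z <- r]) (1 - w *: 'X).
  by rewrite prodE scalerA divfK.
have prod0 : (\prod_(w <- [seq z^-1 | z <- r]) (1 - w *: 'X)).[0] = 1.
  by rewrite horner_prod big1 // => w _; rewrite !hornerE; ring.
by move: P0; rewrite {1}PE' hornerZ prod0 mulr1 => lc; rewrite {1}PE' lc scale1r.
Qed.

(** Newton's identities, the coefficient form of T P'(T) = - P(T) (p_1 T + p_2 T^2 + ...) with p_r
    the power sums, proved by adding one inverse root at a time. *)
Lemma newton_inverse_roots s (P := \prod_(w <- s) (1 - w *: 'X)) k :
  P`_k *+ k = - \sum_(r < k) (\sum_(w <- s) w ^+ r.+1) * P`_(k - r.+1).
Proof.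
rewrite {}/P; elim: s k => [|w s IHs] k.
  rewrite big_nil big1 => [|r _]; last by rewrite big_nil mul0r.
  by rewrite coef1; case: k => [|k]; rewrite ?mulr0n ?oppr0 ?mul0rn.
rewrite big_cons; set P := \prod_(_ <- s) _ in IHs *.
have PE j : ((1 - w *: 'X) * P)`_j = P`_j - w * ('X * P)`_j.
  by rewrite mulrBl mul1r coefB -scalerAl coefZ.
case: k => [|k]; first by rewrite mulr0n big_ord0 oppr0.
(* Dividing by 1 - w T is multiplying by the geometric series in w T. *)
have tele m : \sum_(r < m.+1) w ^+ r * ((1 - w *: 'X) * P)`_(m - r) = P`_m.
  elim: m => [|m IHm].
    by rewrite big_ord1 PE coefXM mulr0 subr0 expr0 mul1r.
  rewrite big_ord_recl /= expr0 mul1r -[in RHS](addrNK (w * P`_m) P`_m.+1).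
  rewrite PE coefXM /=; congr (_ + _); rewrite -IHm mulr_sumr.
  by apply: eq_bigr => r _; rewrite exprS mulrA.
have -> : \sum_(r < k.+1) (\sum_(x <- w :: s) x ^+ r.+1) *
    ((1 - w *: 'X) * P)`_(k.+1 - r.+1) =
    \sum_(r < k.+1) (\sum_(x <- s) x ^+ r.+1) * P`_(k.+1 - r.+1)
    - w * \sum_(r < k.+1) (\sum_(x <- s) x ^+ r.+1) * ('X * P)`_(k - r)
    + w * \sum_(r < k.+1) w ^+ r * ((1 - w *: 'X) * P)`_(k - r).
  rewrite !mulr_sumr -sumrB -big_split /=; apply: eq_bigr => r _.
  by rewrite big_cons PE subSS exprS; ring.
have := IHs k.+1; move/(congr1 -%R); rewrite opprK => <-.
rewrite tele big_ord_recr /= subnn coefXM mulr0 addr0.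
have -> : \sum_(r < k) (\sum_(x <- s) x ^+ r.+1) * ('X * P)`_(k - r)
    = - (P`_k *+ k).
  rewrite IHs opprK; apply: eq_bigr => r _; rewrite coefXM subn_eq0 leqNgt ltn_ord /=.
  by rewrite subnS.
rewrite PE coefXM /=; ring.
Qed.

(** Since P(0) = 1, each identity determines the next term from the earlier ones, so the recursion
    has a single solution. *)
Lemma newton_inverse_roots_unique s (S : nat -> K) :
  let P := \prod_(w <- s) (1 - w *: 'X) in
  (forall k, P`_k *+ k = \sum_(r < k) S r.+1 * P`_(k - r.+1)) ->
  forall k, S k.+1 = - \sum_(w <- s) w ^+ k.+1.
Proof.
move=> P SE; have P0 : P`_0 = 1.
  rewrite -horner_coef0 horner_prod big1 // => w _.
  by rewrite !hornerE; ring.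
elim/ltn_ind => k IHk; have := SE k.+1; rewrite newton_inverse_roots -/P.
rewrite !big_ord_recr /= subnn P0 !mulr1 opprD => /eqP.
rewrite (eq_bigr (fun r : 'I_k => - (S r.+1 * P`_(k.+1 - r.+1)))); last first.
  by move=> r _; rewrite IHk // mulNr opprK.
by rewrite sumrN opprK (inj_eq (addrI _)) eq_sym => /eqP.
Qed.

End InverseRoots.

(** Bernoulli's inequality 1 + t x <= (1 + x)^t makes the powers unbounded when x > 0. *)
Lemma bernoulli_bound (R : archiNumFieldType) (x C : R) (t0 : nat) :
  0 <= x -> (forall t, (t0 <= t)%N -> (1 + x) ^+ t <= C) -> x = 0.
Proof.
move=> x_ge0 xC; apply/eqP; case: eqVneq => // nzx.
have x_gt0 : 0 < x by rewrite lt_def nzx.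
have bern t : 1 + x *+ t <= (1 + x) ^+ t.
  elim: t => [|t IHt]; first by rewrite mulr0n addr0 expr0.
  rewrite exprS (le_trans _ (ler_wpM2l _ IHt)) ?addr_ge0 //.
  rewrite mulrDl mul1r mulrDr mulr1 mulrS; rewrite -!addrA lerD2l addrCA lerD2l lerDl.
  by rewrite mulr_ge0 // mulrn_wge0.
have C_ge0 : 0 <= C by apply: le_trans (xC _ (leqnn _)); rewrite exprn_ge0 // addr_ge0.
pose t := maxn t0 (Num.bound (C / x)).
have := le_trans (bern t) (xC t (leq_maxl _ _)); rewrite lt_geF //.
rewrite (@lt_le_trans _ _ (x *+ t)) ?lerDr //.
rewrite -mulr_natr mulrC -ltr_pdivrMr //.
by rewrite (lt_le_trans (archi_boundP _)) ?divr_ge0 // ler_nat leq_maxr.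
Qed.

(** A non-zero multiple of w^t is a fixed combination of power sums, so (|w| / b)^t stays bounded as
    t grows, whatever the size of C; hence |w| <= b. *)
Lemma power_sum_root_bound (s : seq algC) (b C : algC) (t0 : nat) :
  0 < b -> (forall t, (t0 <= t)%N -> `|\sum_(w <- s) w ^+ t| <= C * b ^+ t) ->
  forall w, w \in s -> `|w| <= b.
Proof.
move=> b_gt0 sumC w ws; have b_ge0 := ltW b_gt0.
rewrite real_leNgt ?ger0_real ?normr_ge0 //; apply/negP => ltbw.
(* Weighting the power sums by the coefficients of [h] leaves only [w]. *)
pose h := \prod_(z <- rem w (undup s)) ('X - z%:P).
have hw : h.[w] != 0.
  rewrite -/(root h w) root_prod_XsubC mem_rem_uniq ?undup_uniq //.
  by rewrite inE eqxx.
have hz z : z \in s -> z != w -> h.[z] = 0.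
  move=> zs nezw; apply/eqP; rewrite -/(root h z) root_prod_XsubC.
  by rewrite mem_rem_uniq ?undup_uniq // inE nezw mem_undup.
pose c := (count_mem w s)%:R * h.[w].
have nzc : c != 0 by rewrite mulf_neq0 // pnatr_eq0 -lt0n -has_count has_pred1.
have wE t : c * w ^+ t = \sum_(l < size h) h`_l * \sum_(z <- s) z ^+ (t + l).
  transitivity (\sum_(z <- s) h.[z] * z ^+ t).
    rewrite (bigID (pred1 w)) /= [X in _ + X]big1_seq ?addr0; last first.
      by move=> z /andP[nez zs]; rewrite hz // mul0r.
    rewrite (eq_bigr (fun=> h.[w] * w ^+ t)); last by move=> z /eqP ->.
    by rewrite big_const_seq -/(count_mem w s) iter_addr_0 -[RHS]mulr_natl mulrA.
  under [RHS]eq_bigr do rewrite mulr_sumr.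
  rewrite exchange_big /=; apply: eq_bigr => z _.
  rewrite horner_coef mulr_suml; apply: eq_bigr => l _.
  by rewrite exprD; ring.
pose B := \sum_(l < size h) `|h`_l| * (C * b ^+ l).
have bound t : (t0 <= t)%N -> (`|w| / b) ^+ t <= B / `|c|.
  move=> le0t; rewrite ler_pdivlMr ?normr_gt0 // exprMn exprVn mulrAC.
  rewrite ler_pdivrMr ?exprn_gt0 // mulrC -normrX -normrM wE.
  apply: le_trans (ler_norm_sum _ _ _) _; rewrite /B mulr_suml.
  apply: ler_sum => l _; rewrite normrM -mulrA ler_wpM2l //.
  apply: le_trans (sumC _ (leq_trans le0t (leq_addr _ _))) _.
  by rewrite addnC exprD mulrA.
have : `|w| / b - 1 = 0.
  apply: (@bernoulli_bound _ _ (B / `|c|) t0); last by move=> t; rewrite addrC subrK; exact: bound.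
  by rewrite subr_ge0 ler_pdivlMr // mul1r ltW.
by move/eqP; rewrite subr_eq0 -subr_eq0 -[1](divff (lt0r_neq0 b_gt0)) -mulrBl mulf_eq0 subr_eq0
  invr_eq0 (gt_eqF b_gt0) (gt_eqF ltbw).
Qed.

(** The 2n-th powers of the inverse roots have t-th power sums O(q^(n t)), so each has modulus at
    most q^n and each inverse root at most sqrt q. The first coefficient is minus the sum of at most
    n - 1 of them. *)
Lemma weil_from_weak_bound (P : {poly algC}) (S : nat -> algC) (q n t0 : nat)
    (C : algC) :
  (0 < q)%N -> (0 < n)%N -> P.[0] = 1 -> (size P <= n)%N ->
  (forall k, P`_k *+ k = \sum_(r < k) S r.+1 * P`_(k - r.+1)) ->
  (forall t, (t0 <= t)%N -> `|S (n.*2 * t)%N| <= C * (q ^ (n * t))%:R) ->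
  `|P`_1| <= n.-1%:R * sqrtC q%:R.
Proof.
move=> q_gt0 n_gt0 P0 sP SE Sbound.
have [s PE ss] := factor_inverse_roots P0.
have Spow k : S k.+1 = - \sum_(w <- s) w ^+ k.+1.
  by apply: newton_inverse_roots_unique; rewrite -PE.
have qR_ge0 : 0 <= q%:R :> algC by [].
have sq_gt0 : 0 < sqrtC q%:R :> algC by rewrite sqrtC_gt0 ltr0n.
have ws w : w \in s -> `|w| <= sqrtC q%:R.
  move=> win; rewrite -(ler_pXn2r (_ : 0 < n.*2)%N) ?nnegrE ?sqrtC_ge0 //; last first.
    by rewrite double_gt0.
  rewrite -mul2n [in leRHS]exprM sqrtCK -normrX mul2n.
  apply: (@power_sum_root_bound [seq z ^+ n.*2 | z <- s] _ C (maxn 1 t0)).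
  - by rewrite exprn_gt0 ?ltr0n.
  - move=> t; rewrite geq_max => /andP[t_gt0 le0t].
    rewrite big_map -exprM -natrX -normrN; have := Sbound t le0t.
    have -> : (n.*2 * t = (n.*2 * t).-1.+1)%N by rewrite prednK // muln_gt0 double_gt0 n_gt0.
    rewrite Spow prednK ?muln_gt0 ?double_gt0 ?n_gt0 //.
    by under [in X in _ -> X]eq_bigr do rewrite -exprM.
  by apply/mapP; exists w.
have := SE 1%N; rewrite mulr1n big_ord1 Spow subnn -horner_coef0 P0 mulr1 => ->.
rewrite normrN; apply: le_trans (ler_norm_sum _ _ _) _.
apply: (@le_trans _ _ (\sum_(w <- s) sqrtC q%:R)).
  by rewrite big_seq [leRHS]big_seq; apply: ler_sum => w /ws; rewrite expr1.
rewrite big_const_seq count_predT iter_addr_0 -[leLHS]mulr_natl ler_pM2r // ler_nat.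
by rewrite ss -!subn1 leq_sub2r.
Qed.

(** * Finite fields inside an algebraically closed field *)

(** The proof relating q to the characteristic is an argument of the map, so that its ring morphism
    structure can be declared. *)
Definition frobenius (F : fieldType) (q : nat) (_ : [pchar F].-nat q) (x : F) : F :=
  x ^+ q.

Section Frobenius.
Variables (F : fieldType) (q : nat) (cq : [pchar F].-nat q).

Fact frobenius_is_zmod_morphism : zmod_morphism (frobenius cq).
Proof.
move=> x y; rewrite /frobenius; apply/(addIr (y ^+ q)).
by rewrite -exprDn_pchar // !subrK.
Qed.

Fact frobenius_is_monoid_morphism : monoid_morphism (frobenius cq).
Proof. by split=> [|x y]; rewrite /frobenius ?expr1n ?exprMn. Qed.

HB.instance Definition _ :=
  GRing.isZmodMorphism.Build F F (frobenius cq) frobenius_is_zmod_morphism.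
HB.instance Definition _ :=
  GRing.isMonoidMorphism.Build F F (frobenius cq) frobenius_is_monoid_morphism.

Lemma exprBn_frobenius (x y : F) : (x - y) ^+ q = x ^+ q - y ^+ q.
Proof. exact: (rmorphB (frobenius cq)). Qed.

Lemma frobenius_pow_nat r : [pchar F].-nat (q ^ r)%N.
Proof. by rewrite pnatX cq. Qed.

End Frobenius.

Lemma exprq_iter_fixed (F : fieldType) (q r i : nat) (a : F) :
  a ^+ (q ^ r) = a -> a ^+ (q ^ (r * i)) = a.
Proof.
move=> ar; elim: i => [|i IHi]; first by rewrite muln0 expr1.
by rewrite mulnS expnD exprM ar.
Qed.

(** By Bezout u r = v s + gcd(r, s), and raising to the powers q^(u r) and q^(v s) fixes a. *)
Lemma exprq_gcdn_fixed (F : fieldType) (q r s : nat) (a : F) : (0 < r)%N ->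
  a ^+ (q ^ r) = a -> a ^+ (q ^ s) = a -> a ^+ (q ^ gcdn r s) = a.
Proof.
move=> r_gt0 ar as_; have [u v uv _] := egcdnP s r_gt0.
rewrite -{1}(exprq_iter_fixed v as_) -exprM -expnD.
by rewrite mulnC -uv mulnC exprq_iter_fixed.
Qed.

Section FixedPoints.
Variables (O : closedFieldType) (q : nat).
Hypotheses (cq : [pchar O].-nat q) (q_gt1 : (1 < q)%N).

(* The subfield of order [q ^ r], as a list. *)
Definition fixed_points (r : nat) : seq O :=
  sval (closed_field_poly_normal ('X^(q ^ r) - 'X : {poly O})).

(** The derivative of X^(q^r) - X is -1, so its roots are simple. *)
Lemma fixed_points_spec r : (0 < r)%N ->
  [/\ uniq (fixed_points r), size (fixed_points r) = (q ^ r)%N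
    & fixed_points r =i [pred a | a ^+ (q ^ r) == a]].
Proof.
move=> r_gt0; rewrite /fixed_points; case: closed_field_poly_normal => s /= sE.
have Q_gt1 : (1 < q ^ r)%N by rewrite -(exp1n r) ltn_exp2r.
have sz : size ('X^(q ^ r) - 'X : {poly O}) = (q ^ r).+1.
  by rewrite size_polyDl ?size_polyXn // size_polyN size_polyX.
have lc : lead_coef ('X^(q ^ r) - 'X : {poly O}) = 1.
  by rewrite lead_coefDl ?lead_coefXn // size_polyXn size_polyN size_polyX.
rewrite lc scale1r in sE; split.
- rewrite -separable_prod_XsubC -sE separable_poly.unlock derivB derivXn derivX.
  have -> : 'X^((q ^ r).-1) *+ (q ^ r) = 0 :> {poly O}.
    rewrite -mulr_natr.
    have /eqP -> : (q ^ r)%:R == 0 :> {poly O}; last by rewrite mulr0.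
    have [p p_pr pq] := pdivP Q_gt1.
    have cp : p \in [pchar O].
      apply: (pnatP _ _ (frobenius_pow_nat cq r)); rewrite // expn_gt0.
      by rewrite (ltnW q_gt1).
    have cp' : p \in [pchar {poly O}] by rewrite pchar_poly.
    by rewrite -(dvdn_pcharf cp').
  by rewrite sub0r -[- 1]scaleN1r coprimepZr ?coprimep1 // oppr_eq0 oner_eq0.
- by apply/eqP; rewrite -eqSS -sz sE size_prod_XsubC.
move=> a; by rewrite -root_prod_XsubC -sE /root !hornerE subr_eq0.
Qed.

Lemma mem_fixed_points r a : (0 < r)%N ->
  (a \in fixed_points r) = (a ^+ (q ^ r) == a).
Proof. by move=> r_gt0; case: (fixed_points_spec r_gt0) => _ _ ->. Qed.

End FixedPoints.

(** * The character sums over the constant field extensions *)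

Lemma big_ord_mul (R : Type) (idx : R) (op : Monoid.law idx) (n s : nat) (F : nat -> R) :
  \big[op/idx]_(j < n * s) F j =
  \big[op/idx]_(i < s) \big[op/idx]_(k < n) F (n * i + k)%N.
Proof.
elim: s => [|s IHs]; first by rewrite muln0 !big_ord0.
rewrite big_ord_recr -IHs /= mulnS addnC.
by rewrite big_split_ord.
Qed.

Section ExtensionSums.
Variables (O : closedFieldType) (q n : nat) (beta : O) (chi : O -> algC).
Hypotheses (cq : [pchar O].-nat q) (q_gt1 : (1 < q)%N) (n_gt0 : (0 < n)%N).
Hypothesis beta_fixed : beta ^+ (q ^ n) = beta.
Hypothesis beta_conj : forall k, (0 < k < n)%N -> beta ^+ (q ^ k) != beta.
Hypothesis chi0 : chi 0 = 0.
Hypothesis chi_le1 : forall x, `|chi x| <= 1.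
Hypothesis sum_chi : \sum_(x <- fixed_points O q n) chi x = 0.

(** For a in F_(q^r), this is the value at [beta] of the characteristic polynomial of a over F_q. *)
Definition orbit_norm (r : nat) (a : O) : O := \prod_(j < r) (beta - a ^+ (q ^ j)).

Definition ext_sum (r : nat) : algC :=
  \sum_(a <- fixed_points O q r) chi (orbit_norm r a).

Let f0 (a : O) : O := orbit_norm n a.

(** Writing j = n i + k, the block of index i is the q^(n i)-th power of f0(a), as [beta] is fixed
    by q^n. For a in F_(q^(n s)) the result is the norm of f0(a) to F_(q^n). *)
Let orbit_normE (s : nat) a : (0 < s)%N ->
  orbit_norm (n * s) a = f0 a ^+ (\sum_(i < s) (q ^ n) ^ i).
Proof.
move=> s_gt0; rewrite /orbit_norm (big_ord_mul _ n s (fun j => beta - a ^+ (q ^ j))) /=.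
rewrite expr_sum; apply: eq_bigr => i _; rewrite -prodrXl; apply: eq_bigr => k _.
rewrite -expnM exprBn_frobenius ?frobenius_pow_nat // exprq_iter_fixed //.
by rewrite -exprM -expnD addnC.
Qed.

Let d := (q ^ n).-1.
Let f : {poly O} := \prod_(k < n) (beta%:P - ('X + beta%:P) ^+ (q ^ k)).

Let hornerf a : f.[a - beta] = f0 a.
Proof.
rewrite horner_prod; apply: eq_bigr => k _.
by rewrite !hornerE subrK.
Qed.

(** The translation in f moves the root [beta] of f0 to 0. The factor for k = 0 is -X; the others
    are non-zero at 0 because the other conjugates of [beta] differ from it. The independence of
    Stepanov's terms rests on this simple root. *)
Let f_simple_root : exists2 h, f = 'X * h & h.[0] != 0.
Proof.
rewrite /f -(prednK n_gt0) big_ord_recl /= expn0 expr1 opprD addrCA subrr addr0 mulNr.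
exists (- \prod_(k < n.-1) (beta%:P - ('X + beta%:P) ^+ (q ^ k.+1))).
  by rewrite mulrN.
rewrite hornerN oppr_eq0 horner_prod; apply/prodf_neq0 => k _.
rewrite !hornerE subr_eq0 eq_sym beta_conj //.
by rewrite /= -ltn_predRL ltn_ord.
Qed.

(** With Q = q^(n s), a non-zero f0(a) has (Q - 1)-th power 1, and the exponent of the norm is (Q -
    1) / (q^n - 1). *)
Let orbit_norm_fixed s a : (0 < s)%N -> a ^+ (q ^ (n * s)) = a ->
  orbit_norm (n * s) a \in fixed_points O q n.
Proof.
move=> s_gt0 aQ; rewrite mem_fixed_points // orbit_normE //.
have Qd : ((q ^ (n * s)).-1 = d * \sum_(i < s) (q ^ n) ^ i)%N by rewrite expnM predn_exp.
have qn_gt0 : (0 < q ^ n)%N by rewrite expn_gt0 ltnW.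
have [f00 | nzf0] := eqVneq (f0 a) 0.
  rewrite f00 expr0n; case: (_ == 0%N); first by rewrite expr1n.
  by rewrite expr0n gtn_eqF.
have f0Q : f0 a ^+ (q ^ (n * s)).-1 = 1.
  apply: (mulIf nzf0); rewrite mul1r -exprSr prednK ?expn_gt0 ?(ltnW q_gt1) //.
  rewrite -prodrXl; apply: eq_bigr => k _.
  rewrite exprBn_frobenius ?frobenius_pow_nat // exprq_iter_fixed //.
  by rewrite -exprM mulnC exprM aQ.
set v := (\sum_(i < s) _)%N in Qd *.
by rewrite -(prednK qn_gt0) exprSr -/d -exprM [(v * d)%N]mulnC -Qd f0Q mul1r.
Qed.

(** Stepanov's method bounds the number N(c) of a with orbit norm c only from above. As the N(c) add
    up to Q and chi has sum zero, d S_r is minus the sum over c != 0 of chi(c) times the deficit Q +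
    C q0 - d N(c) >= 0; the deficits add up to d (C q0 + N(0)). *)
Lemma ext_sum_weak_bound : exists C t0 : nat, forall t, (t0 <= t)%N ->
  `|ext_sum (n.*2 * t)| <= C%:R * (q ^ (n * t))%:R.
Proof.
have [h fE h0] := f_simple_root.
pose D := (size f).-1.
have d_gt0 : (0 < d)%N.
  by rewrite -ltnS prednK ?expn_gt0 ?(ltnW q_gt1) // -(exp1n n) ltn_exp2r.
have nzf : f != 0.
  rewrite fE mulf_neq0 ?polyX_eq0 //.
  by apply: contraNneq h0 => ->; rewrite horner0.
(* The summand [size f] pays for N(0), and t >= 2 d + 2 ensures the lower bound on q0 that
   [stepanov_bound] asks for. *)
exists (stepanov_const d D + (size f))%N, (2 * d + 2)%N => t le_t.
have t_gt0 : (0 < t)%N by lia.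
(* The even s makes Q a square. *)
pose s := t.*2; have s_gt0 : (0 < s)%N by rewrite double_gt0.
have rE : (n.*2 * t = n * s)%N by rewrite /s -!mul2n; ring.
pose Q := (q ^ (n * s))%N; pose q0 := (q ^ (n * t))%N.
pose u := (\sum_(i < s) (q ^ n) ^ i)%N.
have Qq0 : Q = (q0 ^ 2)%N by rewrite /Q /q0 -expnM -rE -mul2n; congr (_ ^ _)%N; ring.
have QE : Q = (d * u).+1.
  by rewrite -predn_exp -expnM prednK // expn_gt0 (ltnW q_gt1).
have r_gt0 : (0 < n * s)%N by rewrite muln_gt0 n_gt0.
have [uA sA memA] := fixed_points_spec cq q_gt1 r_gt0.
have [uK sK memK] := fixed_points_spec cq q_gt1 n_gt0.
pose N c := count (fun a => orbit_norm (n * s) a == c) (fixed_points O q (n * s)).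
have q0_big : (2 * d + 2 <= q0)%N.
  apply: leq_trans le_t _; apply: ltnW; apply: leq_trans (ltn_expl _ q_gt1) _.
  by rewrite leq_exp2l // leq_pmull.
have N_le c : (d * N c <= Q + stepanov_const d D * q0)%N.
  have [p p_pr pq] := pdivP q_gt1.
  have cp : p \in [pchar O] by apply: (pnatP _ _ cq); rewrite ?(ltnW q_gt1).
  have pQ : p.-nat Q.
    by rewrite -(eq_pnat _ (pcharf_eq cp)); apply: frobenius_pow_nat.
  pose B := [seq a - beta | a <- fixed_points O q (n * s) & orbit_norm (n * s) a == c].
  have -> : N c = size B by rewrite size_map size_filter.
  apply: (stepanov_bound (c := c) cp pQ Qq0 QE d_gt0 q0_big fE h0).
  - by rewrite /D -ltnS; case: (size f).
  - by rewrite map_inj_uniq ?filter_uniq //; exact: addIr.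
  move=> b /mapP[a]; rewrite mem_filter memA inE => /andP[/eqP <- /eqP aQ] ->.
  rewrite hornerf exprBn_frobenius ?frobenius_pow_nat // aQ exprq_iter_fixed //.
  by rewrite orbit_normE.
have N0_le : (N 0%R <= size f)%N.
  rewrite /N -size_filter -(size_map (fun a => a - beta)).
  apply: ltnW; apply: max_poly_roots => //; last first.
    by rewrite map_inj_uniq ?filter_uniq //; exact: addIr.
  apply/allP => b /mapP[a]; rewrite mem_filter orbit_normE // => /andP[].
  by rewrite expf_eq0 /root => /andP[_ f0a] _ ->; rewrite hornerf.
have sum_delta (R : pzSemiRingType) (g : O -> R) a : a \in fixed_points O q n ->
    \sum_(c <- fixed_points O q n) g c * (a == c)%:R = g a.
  move=> aK; rewrite (bigD1_seq a) //= eqxx mulr1 big1 ?addr0 // => c.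
  by rewrite eq_sym => /negPf ->; rewrite mulr0.
have NE (R : pzSemiRingType) c :
    (N c)%:R = \sum_(a <- fixed_points O q (n * s)) (orbit_norm (n * s) a == c)%:R :> R.
  by rewrite -natr_sum /N -sum1_count big_mkcond.
have UK a : a \in fixed_points O q (n * s) -> orbit_norm (n * s) a \in fixed_points O q n.
  by rewrite memA => /eqP; apply: orbit_norm_fixed.
have sumN : \sum_(c <- fixed_points O q n) (N c)%:R = Q%:R :> algC.
  under eq_bigr do rewrite NE.
  rewrite exchange_big /= -[Q]sA -sum1_size natr_sum big_seq [RHS]big_seq.
  apply: eq_bigr => a /UK aK; rewrite -[RHS](sum_delta _ (fun=> 1) _ aK).
  by apply: eq_bigr => c _; rewrite mul1r.
have extE : ext_sum (n * s) = \sum_(c <- fixed_points O q n) chi c * (N c)%:R.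
  under [RHS]eq_bigr do rewrite NE mulr_sumr.
  rewrite exchange_big /= /ext_sum big_seq [RHS]big_seq.
  by apply: eq_bigr => a /UK aK; rewrite sum_delta.
pose C := stepanov_const d D; pose U := (Q + C * q0)%N.
have dR_gt0 : 0 < d%:R :> algC by rewrite ltr0n.
have K0 : 0 \in fixed_points O q n.
  by rewrite memK inE expr0n expn_eq0 -leqn0 leqNgt (ltnW q_gt1).
have sK1 : \sum_(c <- fixed_points O q n | c != 0) 1 = d%:R :> algC.
  apply/(addrI 1); rewrite -(@bigD1_seq _ _ _ _ _ 0 (fun=> 1) K0 uK).
  have -> : \sum_(c <- fixed_points O q n) 1 = (q ^ n)%:R :> algC.
    by rewrite -sK -sum1_size natr_sum.
  by rewrite -mulrS prednK // expn_gt0 ltnW.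
rewrite rE extE -/q0 -(ler_pM2l dR_gt0) -{1}(ger0_norm (ltW dR_gt0)) -normrM.
have -> : d%:R * \sum_(c <- fixed_points O q n) chi c * (N c)%:R =
    - \sum_(c <- fixed_points O q n | c != 0) chi c * (U%:R - d%:R * (N c)%:R).
  pose g c := chi c * (U%:R - d%:R * (N c)%:R).
  have <- : \sum_(c <- fixed_points O q n) g c =
      \sum_(c <- fixed_points O q n | c != 0) g c.
    by rewrite (bigD1_seq 0) //= /g chi0 mul0r add0r.
  rewrite /g; under [in RHS]eq_bigr do rewrite mulrBr.
  rewrite sumrB -mulr_suml sum_chi mul0r sub0r opprK mulr_sumr.
  by apply: eq_bigr => c _; rewrite mulrCA.
rewrite normrN; apply: le_trans (ler_norm_sum _ _ _) _.
apply: (@le_trans _ _ (\sum_(c <- fixed_points O q n | c != 0) (U%:R - d%:R * (N c)%:R))).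
  apply: ler_sum => c _; rewrite normrM -natrM [X in _ * X]ger0_norm ?subr_ge0 ?ler_nat //.
  by rewrite ler_piMl // subr_ge0 ler_nat.
have sumN' : \sum_(c <- fixed_points O q n | c != 0) (N c)%:R = Q%:R - (N 0)%:R :> algC.
  by rewrite -sumN (bigD1_seq 0) //= addrAC subrr add0r.
rewrite sumrB -mulr_sumr sumN' (eq_bigr (fun=> U%:R * 1)) => [|c _]; last by rewrite mulr1.
rewrite -mulr_sumr sK1 mulrC -mulrBr ler_pM2l // /U natrD opprB addrC addrA subrK addrC.
rewrite -natrM -natrD ler_nat mulnDl leq_add2l.
by rewrite (leq_trans N0_le) // leq_pmulr // expn_gt0 ltnW.
Qed.
End ExtensionSums.

(** * Polynomials over the field with [q] elements *)

Section FixedPolynomials.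
Variables (O : closedFieldType) (q : nat).
Hypotheses (cq : [pchar O].-nat q) (q_gt1 : (1 < q)%N).
Implicit Types f g : {poly O}.

Definition frob_fixed f : bool := map_poly (frobenius cq) f == f.

Lemma frob_fixedP f : reflect (forall i, f`_i ^+ q = f`_i) (frob_fixed f).
Proof.
apply: (iffP eqP) => [fE i|fE]; first by rewrite -{2}fE coef_map.
by apply/polyP => i; rewrite coef_map; apply: fE.
Qed.

Lemma frob_fixed_horner f x i : frob_fixed f -> f.[x] ^+ (q ^ i) = f.[x ^+ (q ^ i)].
Proof.
move=> /eqP fE; elim: i => [|i IHi]; first by rewrite !expn0 !expr1.
rewrite expnSr !exprM IHi -{2}fE; exact: (esym (horner_map (frobenius cq) _ _)).
Qed.

(* Only the [k] lowest coefficients vary; [f0] holds the others. *)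
Fixpoint poly_ext (f0 : {poly O}) (k : nat) : seq {poly O} :=
  if k is k'.+1 then
    [seq g * 'X + a%:P | g <- poly_ext f0 k', a <- fixed_points O q 1]
  else [:: f0].

Lemma poly_ext_uniq f0 k : uniq (poly_ext f0 k).
Proof.
elim: k => //= k IHk; have [uK _ _] := fixed_points_spec cq q_gt1 (isT : 0 < 1)%N.
apply: allpairs_uniq => // [[g a] [h b]] _ _ /= E.
have ab : a = b.
  by have := congr1 (horner^~ 0) E; rewrite !hornerE => ->.
by move: E; rewrite ab => /addIr /(mulIf (negbT (polyX_eq0 O))) ->.
Qed.

Lemma size_poly_ext f0 k : size (poly_ext f0 k) = (q ^ k)%N.
Proof.
elim: k => //= k IHk; have [_ sK _] := fixed_points_spec cq q_gt1 (isT : 0 < 1)%N.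
by rewrite size_allpairs IHk sK expn1 expnSr.
Qed.

Lemma mem_poly_ext f0 k g :
  reflect (drop_poly k g = f0 /\ forall i, (i < k)%N -> g`_i ^+ q = g`_i)
          (g \in poly_ext f0 k).
Proof.
elim: k g => [|k IHk] g /=.
  by rewrite inE drop_poly0l; apply: (iffP eqP) => [|[]].
have mem1 a : (a \in fixed_points O q 1) = (a ^+ q == a) by rewrite mem_fixed_points.
apply: (iffP allpairsP) => [[[h a] /= [/IHk[dh ch] Ka ->]]|[dg cg]].
  split.
    apply/polyP => i; rewrite coef_drop_poly addnS -dh coefD coefMX /= coefC /=.
    by rewrite addr0 coef_drop_poly.
  case=> [|i] lti; rewrite coefD coefMX coefC /= ?add0r ?addr0; last exact: ch.
  by apply/eqP; rewrite -mem1.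
exists (drop_poly 1 g, g`_0); split=> /=.
- apply/IHk; split=> [|i lti]; last by rewrite coef_drop_poly addn1 cg.
  by rewrite -dg; apply/polyP => i; rewrite !coef_drop_poly addn1 addnS.
- by rewrite mem1 cg.
apply/polyP => i; rewrite coefD coefMX coefC; case: i => [|i] /=; first by rewrite add0r.
by rewrite addr0 coef_drop_poly addn1.
Qed.

Lemma mem_monics k g :
  (g \in poly_ext 1 k) = [&& g \is monic, size g == k.+1 & frob_fixed g].
Proof.
apply/mem_poly_ext/and3P => [[dg cg]|[/monicP lg /eqP sg /frob_fixedP fg]].
  have sg : size g = k.+1.
    by have := size_drop_poly k g; rewrite dg size_poly1; lia.
  have gk : g`_k = 1 by have := coef_drop_poly k g 0; rewrite dg coef1 add0n.
  split; first by apply/monicP; rewrite lead_coefE sg.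
    by rewrite sg.
  apply/frob_fixedP => i; case: (ltngtP i k) => [/cg //|ltki|->].
    by rewrite nth_default ?sg // expr0n; case: (q) q_gt1.
  by rewrite gk expr1n.
split=> [|i _]; last exact: fg.
apply/polyP => i; rewrite coef_drop_poly coef1; case: i => [|i] /=.
  by rewrite add0n -lg lead_coefE sg.
by rewrite nth_default // sg; lia.
Qed.

(** Grouping by the quotient h by X^k leaves the k lowest coefficients to the inner sum. *)
Lemma big_poly_ext_add (R : Type) (idx : R) (op : Monoid.law idx) f0 m k
    (G : {poly O} -> R) :
  \big[op/idx]_(g <- poly_ext f0 (m + k)) G g =
  \big[op/idx]_(h <- poly_ext f0 m) \big[op/idx]_(g <- poly_ext h k) G g.
Proof.
elim: k G => [|k IHk] G; first by rewrite addn0; apply: eq_bigr => h _; rewrite big_seq1.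
rewrite addnS /= big_allpairs_dep IHk; apply: eq_bigr => h _.
by rewrite big_allpairs_dep.
Qed.

End FixedPolynomials.

(** * The L-function *)

Section LFunction.
Variables (O : closedFieldType) (q n : nat) (beta : O) (chi : O -> algC).
Hypotheses (cq : [pchar O].-nat q) (q_gt1 : (1 < q)%N) (n_gt0 : (0 < n)%N).
Hypothesis beta_fixed : beta ^+ (q ^ n) = beta.
Hypothesis beta_conj : forall k, (0 < k < n)%N -> beta ^+ (q ^ k) != beta.
Hypothesis sum_chi : \sum_(x <- fixed_points O q n) chi x = 0.

(** The coefficient of T^k in the L-function, the sum of chi(f(beta)) T^(deg f) over monic f over
    F_q. *)
Definition lcoef (k : nat) : algC := \sum_(f <- poly_ext q 1 k) chi f.[beta].

Lemma conj_uniq : uniq [seq beta ^+ (q ^ i) | i <- iota 0 n].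
Proof.
rewrite map_inj_in_uniq ?iota_uniq // => i j; rewrite !mem_iota !add0n /=.
wlog ltij : i j / (i < j)%N => [hw lti ltj E|lti ltj E].
  by case: (ltngtP i j) => // ltij; [|apply/esym]; apply: hw.
have /negP[] : beta ^+ (q ^ (n - j + i)) != beta by apply: beta_conj; lia.
by rewrite addnC expnD exprM E -exprM -expnD subnKC // ?beta_fixed // ltnW.
Qed.

(** Evaluation at [beta] is injective here: a difference of two members has degree below n and
    coefficients in F_q, and if it vanishes at [beta] it does so at n distinct conjugates. There are
    q^n members, so the values fill F_(q^n). *)
Lemma sum_chi_poly_ext f0 : frob_fixed cq f0 ->
  \sum_(g <- poly_ext q f0 n) chi g.[beta] = 0.
Proof.
move=> /frob_fixedP f0P; rewrite -[RHS]sum_chi.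
have extP g : g \in poly_ext q f0 n -> frob_fixed cq g.
  move=> /(mem_poly_ext cq q_gt1)[dg cg]; apply/frob_fixedP => i.
  case: (ltnP i n) => [/cg //|leni].
  by have := f0P (i - n)%N; rewrite -dg coef_drop_poly subnK.
rewrite -(big_map (horner^~ beta) predT chi); apply: perm_big.
have [uK sK memK] := fixed_points_spec cq q_gt1 n_gt0.
have uE : uniq [seq g.[beta] | g <- poly_ext q f0 n].
  rewrite map_inj_in_uniq ?poly_ext_uniq // => g h gE hE gh.
  apply/eqP; rewrite -subr_eq0; apply/eqP.
  apply: (roots_geq_poly_eq0 (rs := [seq beta ^+ (q ^ i) | i <- iota 0 n])).
  - apply/allP => x /mapP[i _ ->]; rewrite /root !hornerE.
    by rewrite -!(frob_fixed_horner _ _ (extP _ _)) // gh subrr.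
  - exact: conj_uniq.
  rewrite size_map size_iota.
  have : size (drop_poly n (g - h)) = 0%N.
    have [dg _] := mem_poly_ext cq q_gt1 _ _ _ gE.
    have [dh _] := mem_poly_ext cq q_gt1 _ _ _ hE.
    by rewrite raddfB /= dg dh subrr size_poly0.
  by rewrite size_drop_poly => /eqP; rewrite subn_eq0.
have sub : {subset [seq g.[beta] | g <- poly_ext q f0 n] <= fixed_points O q n}.
  move=> x /mapP[g /extP gP ->]; rewrite memK inE.
  by rewrite (frob_fixed_horner _ _ gP) beta_fixed.
apply: uniq_perm => //.
by have [] := uniq_min_size uE sub; rewrite ?size_map ?size_poly_ext // sK.
Qed.

(** With the upper coefficients fixed, the sum over the n lowest ones is already zero. *)
Lemma lcoef_eq0 k : (n <= k)%N -> lcoef k = 0.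
Proof.
move=> lenk; rewrite /lcoef -(subnK lenk) big_poly_ext_add big_seq big1 // => h hP.
by apply: sum_chi_poly_ext; move: hP; rewrite mem_monics // => /and3P[].
Qed.

Lemma lcoef0 : lcoef 0 = chi 1.
Proof. by rewrite /lcoef /= big_seq1 hornerC. Qed.

Lemma lcoef1 : lcoef 1 = \sum_(a <- fixed_points O q 1) chi (a + beta).
Proof.
rewrite /lcoef /= cats0 big_map; apply: eq_bigr => a _.
by rewrite !hornerE addrC.
Qed.

End LFunction.

(** * Orbit polynomials and the degree count *)

Section OrbitPolynomials.
Variables (O : closedFieldType) (q : nat).
Hypotheses (cq : [pchar O].-nat q) (q_gt1 : (1 < q)%N).

(** For a in F_(q^r) of degree d over F_q, this is the (r/d)-th power of the minimal polynomial of
    a. *)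
Definition orbit_poly (r : nat) (a : O) : {poly O} :=
  \prod_(j < r) ('X - (a ^+ (q ^ j))%:P).

Lemma size_orbit_poly r a : size (orbit_poly r a) = r.+1.
Proof. rewrite /orbit_poly -(big_mkord predT (fun j => 'X - (a ^+ (q ^ j))%:P)).
by rewrite size_prod_XsubC size_iota subn0. Qed.

Lemma orbit_poly_monic r a : orbit_poly r a \is monic.
Proof. exact: monic_prod_XsubC. Qed.

Lemma orbit_poly_horner r a x : (orbit_poly r a).[x] = \prod_(j < r) (x - a ^+ (q ^ j)).
Proof. by rewrite horner_prod; apply: eq_bigr => j _; rewrite !hornerE. Qed.

Lemma orbit_poly_root r a : (0 < r)%N -> 'X - a%:P %| orbit_poly r a.
Proof.
move=> r_gt0; rewrite dvdp_XsubCl /root orbit_poly_horner.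
by rewrite (bigD1 (Ordinal r_gt0)) //= expn0 expr1 subrr mul0r.
Qed.

Lemma map_frobenius_XsubC a :
  map_poly (frobenius cq) ('X - a%:P) = 'X - (a ^+ q)%:P.
Proof. by rewrite rmorphB /= map_polyX map_polyC. Qed.

Lemma orbit_poly_fixed r a : a ^+ (q ^ r) = a -> frob_fixed cq (orbit_poly r a).
Proof.
move=> ar; rewrite /frob_fixed /orbit_poly rmorph_prod /=.
case: r ar => [|r] ar; first by rewrite !big_ord0.
apply/eqP; rewrite big_ord_recr [RHS]big_ord_recl mulrC /=; congr (_ * _); last first.
  by rewrite map_frobenius_XsubC -exprM -expnSr ar expn0 expr1.
by apply: eq_bigr => j _; rewrite map_frobenius_XsubC -exprM -expnSr.
Qed.

Lemma orbit_poly_mul d j a : a ^+ (q ^ d) = a ->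
  orbit_poly (d * j) a = orbit_poly d a ^+ j.
Proof.
move=> ad; rewrite /orbit_poly.
rewrite (big_ord_mul _ d j (fun i => 'X - (a ^+ (q ^ i))%:P)) /=.
rewrite -[j in RHS]card_ord -prodr_const; apply: eq_bigr => i _; apply: eq_bigr => k _.
by rewrite expnD exprM exprq_iter_fixed.
Qed.

Lemma exprq_inj r : injective (fun x : O => x ^+ (q ^ r)).
Proof.
move=> x y /eqP; rewrite -subr_eq0 -exprBn_frobenius ?frobenius_pow_nat //.
by rewrite expf_eq0 subr_eq0 => /andP[_ /eqP].
Qed.

Section Multiplicity.
Variables (s : seq O).
Let f := \prod_(x <- s) ('X - x%:P).
Hypothesis f_fixed : frob_fixed cq f.

(** Frobenius is injective and permutes the roots of f with their multiplicities. *)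
Lemma count_conj x i : count_mem (x ^+ (q ^ i)) s = count_mem x s.
Proof.
elim: i => [|i IHi]; first by rewrite expn0 expr1.
have ps : perm_eq [seq y ^+ q | y <- s] s.
  apply: prod_XsubC_eq; rewrite -/f -(eqP f_fixed) /f rmorph_prod big_map /=.
  by apply: eq_bigr => y _; rewrite map_frobenius_XsubC.
rewrite -IHi expnSr exprM -(permP ps) count_map; apply: eq_count => y /=.
by rewrite (inj_eq (@exprq_inj 1)).
Qed.

(** The conjugates of x lie in the finite list s, so they repeat; the least period d divides every
    period r, since gcd(d, r) is again a period. *)
Lemma orbit_degree x : x \in s ->
  exists2 d, (0 < d)%N & forall r, (x ^+ (q ^ r) == x) = (d %| r)%N.
Proof.
move=> xs.
have xis i : x ^+ (q ^ i) \in s.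
  by rewrite -has_pred1 has_count count_conj -has_count has_pred1.
have ex_r : exists r, (0 < r)%N && (x ^+ (q ^ r) == x).
  have /(uniqPn 0) [i [j [ltij ltj]]] :
      ~~ uniq [seq x ^+ (q ^ i) | i <- iota 0 (size s).+1].
    apply/negP => /uniq_leq_size le_s; have := le_s s; rewrite size_map size_iota.
    by rewrite ltnn => le_ss; apply/notF/le_ss => y /mapP[i _ ->].
  rewrite size_map size_iota in ltj.
  rewrite !(nth_map 0%N) ?size_iota ?(ltn_trans ltij) // !nth_iota ?(ltn_trans ltij) //.
  rewrite !add0n => E; exists (j - i)%N; rewrite subn_gt0 ltij /=; apply/eqP.
  apply: (@exprq_inj i); rewrite -exprM -expnD subnK //; exact: ltnW.
case: (ex_minnP ex_r) => d /andP[d_gt0 /eqP xd] mind; exists d => // r.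
apply/eqP/idP => [xr|/dvdnP[j ->]]; last by rewrite mulnC exprq_iter_fixed.
have xg := exprq_gcdn_fixed d_gt0 xd xr.
have : (d <= gcdn d r)%N by apply: mind; rewrite xg eqxx gcdn_gt0 d_gt0.
move=> leg; have <- : gcdn d r = d by apply/eqP; rewrite eqn_leq leg dvdn_leq ?dvdn_gcdl.
exact: dvdn_gcdr.
Qed.

Let nzf : f != 0.
Proof. exact/monic_neq0/monic_prod_XsubC. Qed.

(** The d conjugates of x are distinct roots of f with the multiplicity of x, and the orbit
    polynomial is the j-th power of the product of their linear factors. *)
Lemma orbit_poly_dvd x d j : x \in s -> (0 < d)%N ->
  (forall r, (x ^+ (q ^ r) == x) = (d %| r)%N) ->
  (orbit_poly (d * j) x %| f) = (j <= count_mem x s)%N.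
Proof.
move=> xs d_gt0 dP; have /eqP xd : x ^+ (q ^ d) == x by rewrite dP.
rewrite orbit_poly_mul //; apply/idP/idP => [|lej].
  rewrite -mu_prod_XsubC mup_geq //; apply: dvdp_trans.
  exact/dvdp_exp2r/orbit_poly_root.
have -> : orbit_poly d x = \prod_(a <- [seq x ^+ (q ^ i) | i <- iota 0 d]) ('X - a%:P).
  by rewrite big_map -{2}[d]subn0 -/(index_iota 0 d) big_mkord.
apply: prod_XsubC_exp_dvdp => [|a /mapP[i _ ->]].
  rewrite map_inj_in_uniq ?iota_uniq // => i k; rewrite !mem_iota !add0n /=.
  wlog ltik : i k / (i < k)%N => [hw lti ltk E|lti ltk E].
    by case: (ltngtP i k) => // ltik; [|apply/esym]; apply: hw.
  have : (d %| k - i)%N.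
    rewrite -dP; apply/eqP/(@exprq_inj i); rewrite -exprM -expnD subnK //; exact: ltnW.
  by move/dvdn_leq; lia.
by rewrite -mup_geq // mu_prod_XsubC count_conj.
Qed.

(** The orbit lengths that qualify are d, 2 d, ..., d m with m the multiplicity of x, and d m <=
    k. *)
Lemma count_orbit_seed x k : x \in s -> size s = k ->
  count (fun r => (x ^+ (q ^ r.+1) == x) && (orbit_poly r.+1 x %| f)) (iota 0 k)
  = count_mem x s.
Proof.
move=> xs sk; have [d d_gt0 dP] := orbit_degree xs.
set m := count_mem x s.
have le_dm : (d * m <= k)%N.
  have := orbit_poly_dvd m xs d_gt0 dP; rewrite leqnn => /(dvdp_leq nzf).
  by rewrite size_orbit_poly size_prod_XsubC sk.
rewrite -size_filter -[RHS](size_iota 0 m) -[RHS](size_map (fun i => (d * i.+1).-1)).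
apply: perm_size; apply: uniq_perm => [||r].
- by rewrite filter_uniq ?iota_uniq.
- rewrite map_inj_in_uniq ?iota_uniq // => i j _ _ E; apply/succn_inj/eqP.
  by rewrite -(eqn_pmul2l d_gt0); apply/eqP; move: E; nia.
rewrite mem_filter dP mem_iota add0n.
apply/idP/mapP => [/andP[/andP[/dvdnP[j rj]]]|[i]].
  rewrite rj mulnC (orbit_poly_dvd _ xs d_gt0 dP) -/m => lejm _.
  case: j rj lejm => // j rj lejm; exists j; first by rewrite mem_iota.
  by rewrite mulnC -rj.
rewrite mem_iota add0n => /andP[_ ltim] ->.
have E : (d * i.+1).-1.+1 = (d * i.+1)%N by rewrite prednK // muln_gt0 d_gt0.
rewrite E dvdn_mulr // (orbit_poly_dvd _ xs d_gt0 dP) -/m ltim /=.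
by apply: leq_trans le_dm; rewrite leq_mul2l ltim orbT.
Qed.

End Multiplicity.

(** Exchanging the sums, each distinct root of f is counted as often as its multiplicity, and the
    multiplicities add up to the degree. *)
Lemma count_orbit_poly (f : {poly O}) k : f \in poly_ext q 1 k ->
  (\sum_(r < k) count (fun a => (orbit_poly r.+1 a %| f)%R) (fixed_points O q r.+1))%N = k.
Proof.
rewrite mem_monics // => /and3P[/monicP f1 /eqP sf f_fixed].
have [s fE] := closed_field_poly_normal f; rewrite f1 scale1r in fE.
have sk : size s = k by apply/eqP; rewrite -eqSS -sf fE size_prod_XsubC.
rewrite fE in f_fixed *.
transitivity (\sum_(r < k) \sum_(x <- undup s)
  ((x ^+ (q ^ r.+1) == x) && (orbit_poly r.+1 x %| \prod_(y <- s) ('X - y%:P)))%R)%N.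
  apply: eq_bigr => r _; rewrite -big_mkcond sum1_count -!size_filter.
  have [uK _ memK] := fixed_points_spec cq q_gt1 (isT : 0 < r.+1)%N.
  apply: perm_size; apply: uniq_perm; rewrite ?filter_uniq ?undup_uniq // => x.
  rewrite !mem_filter memK inE mem_undup; case dvdf: (_ %| _) => //=; last by rewrite andbF.
  rewrite andbT; case: eqP => //= _; symmetry; rewrite -root_prod_XsubC.
  by rewrite -dvdp_XsubCl (dvdp_trans (orbit_poly_root x (isT : 0 < r.+1)%N)).
rewrite exchange_big /=.
transitivity (\sum_(x <- undup s) count_mem x s)%N.
  apply: eq_big_seq => x; rewrite mem_undup => xs.
  rewrite -(count_orbit_seed f_fixed xs sk) -sum1_count.
  by rewrite -[X in iota 0 X](subn0 k) -/(index_iota 0 k) big_mkord [RHS]big_mkcond.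
rewrite -sk -sum1_size -[RHS]big_undup_iterop_count; apply: eq_bigr => x _.
by rewrite Monoid.iteropE iter_addn_0 mul1n.
Qed.
End OrbitPolynomials.

Lemma mem_monics_mulr (O : closedFieldType) (q r k : nat) (C g : {poly O}) :
  [pchar O].-nat q -> (1 < q)%N -> (r <= k)%N -> C \in poly_ext q 1 r ->
  (g * C \in poly_ext q 1 k) = (g \in poly_ext q 1 (k - r)).
Proof.
move=> cq q_gt1 lerk; rewrite !(mem_monics cq) // => /and3P[C1 /eqP sC C_fixed].
rewrite monicMr //; case: (boolP (g \is monic)) => //= g1; congr (_ && _).
  rewrite size_Mmonic ?monic_neq0 // sC addnS /=.
  by rewrite -[RHS](eqn_add2r r) addSn subnK.
rewrite /frob_fixed rmorphM /= (eqP C_fixed) (inj_eq (mulIf _)) //.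
exact: monic_neq0.
Qed.

(** * Newton's identities for the L-function and Katz's bound *)

Section KatzClosed.
Variables (O : closedFieldType) (q n : nat) (beta : O) (chi : O -> algC).
Hypotheses (cq : [pchar O].-nat q) (q_gt1 : (1 < q)%N) (n_gt0 : (0 < n)%N).
Hypothesis beta_fixed : beta ^+ (q ^ n) = beta.
Hypothesis beta_conj : forall k, (0 < k < n)%N -> beta ^+ (q ^ k) != beta.
Hypotheses (chi0 : chi 0 = 0) (chi1 : chi 1 = 1).
Hypothesis chi_le1 : forall x, `|chi x| <= 1.
Hypothesis chiM : {in fixed_points O q n &, {morph chi : x y / x * y}}.
Hypothesis sum_chi : \sum_(x <- fixed_points O q n) chi x = 0.

(** The monic multiples of degree k of the orbit polynomial C are the C g with g monic of degree k -
    r, and chi is multiplicative. *)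
Let chi_orbit_mul r k a : (r <= k)%N -> (0 < r)%N -> a \in fixed_points O q r ->
  chi (orbit_norm q beta r a) * lcoef q beta chi (k - r) =
  \sum_(f <- poly_ext q 1 k | orbit_poly q r a %| f) chi f.[beta].
Proof.
move=> lerk r_gt0; rewrite mem_fixed_points // => /eqP ar.
set C := orbit_poly q r a; have C_fixed : frob_fixed cq C by apply: orbit_poly_fixed.
have KP g : frob_fixed cq g -> g.[beta] \in fixed_points O q n.
  by move=> gP; rewrite mem_fixed_points // (frob_fixed_horner _ _ gP) beta_fixed.
rewrite -big_filter; have -> : \sum_(f <- [seq f <- poly_ext q 1 k | C %| f]) chi f.[beta]
    = \sum_(f <- [seq C * g | g <- poly_ext q 1 (k - r)]) chi f.[beta].
  apply: perm_big; apply: uniq_perm => [||f].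
  - by rewrite filter_uniq ?poly_ext_uniq.
  - rewrite map_inj_uniq ?poly_ext_uniq //; apply: mulfI.
    exact/monic_neq0/orbit_poly_monic.
  have CM : C \in poly_ext q 1 r.
    by rewrite (mem_monics cq) // orbit_poly_monic size_orbit_poly eqxx.
  rewrite mem_filter; apply/andP/mapP => [[/dvdpP[g ->]]|[g]].
    by rewrite (mem_monics_mulr g cq q_gt1 lerk CM) => gM; exists g; rewrite // mulrC.
  by move=> gM ->; rewrite dvdp_mulr // mulrC (mem_monics_mulr g cq q_gt1 lerk CM).
rewrite big_map mulr_sumr; apply: eq_big_seq => g.
rewrite (mem_monics cq) // => /and3P[_ _ gP].
have orbE : orbit_norm q beta r a = C.[beta] by rewrite orbit_poly_horner.
by rewrite hornerM orbE chiM ?KP.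
Qed.

(** By [count_orbit_poly], k chi(f(beta)) is the sum of chi(f(beta)) over the pairs (r, a) whose
    orbit polynomial divides f; summing over f first gives the products. *)
Lemma lcoef_newton k : lcoef q beta chi k *+ k =
  \sum_(r < k) ext_sum q beta chi r.+1 * lcoef q beta chi (k - r.+1).
Proof.
transitivity (\sum_(r < k) \sum_(a <- fixed_points O q r.+1)
    \sum_(f <- poly_ext q 1 k) chi f.[beta] *+ (orbit_poly q r.+1 a %| f)%R).
  transitivity (\sum_(f <- poly_ext q 1 k) chi f.[beta] *+
    (\sum_(r < k) count (fun a => (orbit_poly q r.+1 a %| f)%R) (fixed_points O q r.+1))).
    rewrite -sumrMnl; apply: eq_big_seq => f fP.
    by rewrite (count_orbit_poly cq q_gt1 fP).
  under eq_bigr do rewrite -sumrMnr.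
  rewrite exchange_big /=; apply: eq_bigr => r _.
  rewrite exchange_big /=; apply: eq_bigr => f _.
  by rewrite -sumn_count sumnE big_map -sumrMnr.
apply: eq_bigr => r _; rewrite /ext_sum mulr_suml; apply: eq_big_seq => a aK.
rewrite chi_orbit_mul // [RHS]big_mkcond; apply: eq_bigr => f _.
by case: (_ %| _).
Qed.

Lemma katz_bound_closed :
  `|\sum_(a <- fixed_points O q 1) chi (a + beta)| <= n.-1%:R * sqrtC q%:R.
Proof.
pose P : {poly algC} := \poly_(k < n) lcoef q beta chi k.
have PE k : P`_k = lcoef q beta chi k.
  by rewrite coef_poly; case: ltnP => // lenk; rewrite (lcoef_eq0 cq q_gt1 n_gt0).
have [C [t0 Ct]] := ext_sum_weak_bound cq q_gt1 n_gt0 beta_fixed beta_conj chi0 chi_le1 sum_chi.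
rewrite -lcoef1 -PE.
apply: (weil_from_weak_bound (ltnW q_gt1) n_gt0 _ _ _ Ct).
- by rewrite horner_coef0 PE lcoef0.
- exact: size_poly.
by move=> k; rewrite PE lcoef_newton; apply: eq_bigr => r _; rewrite PE.
Qed.

End KatzClosed.

(** * Transfer to the given finite field *)

Section FiniteField.
Variables (L : finFieldType) (p e n : nat).
Let q := (p ^ e)%N.
Hypotheses (p_pr : prime p) (e_gt0 : (0 < e)%N) (n_gt0 : (0 < n)%N).
Hypothesis cardL : #|L| = (q ^ n)%N.

Let q_gt1 : (1 < q)%N.
Proof. by rewrite -(exp1n e) ltn_exp2r ?prime_gt1. Qed.

(** In an algebraic closure of L, the image of L consists of q^n roots of X^(q^n) - X, hence of all
    of them. *)
Lemma finField_closure : exists (O : closedFieldType) (iota : {rmorphism L -> O}),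
  [/\ [pchar O].-nat q,
    perm_eq (fixed_points O q n) [seq iota x | x <- enum L]
  & perm_eq (fixed_points O q 1) [seq iota x | x <- enum L & x ^+ q == x]].
Proof.
have cL : p \in [pchar L] by apply: (card_finPcharP (n := (e * n)%N)); rewrite // expnM.
have [O [iota _]] := countable_algebraic_closure L.
have iotaI : injective iota by exact: fmorph_inj.
have cO : p \in [pchar O] by rewrite (fmorph_pchar iota).
have cq : [pchar O].-nat q by rewrite (eq_pnat _ (pcharf_eq cO)) pnatX pnat_id.
exists O, iota.
have permK : perm_eq (fixed_points O q n) [seq iota x | x <- enum L].
  have [uK sK memK] := fixed_points_spec cq q_gt1 n_gt0.
  rewrite perm_sym; have uL : uniq [seq iota x | x <- enum L].
    by rewrite map_inj_uniq ?enum_uniq.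
  apply: uniq_perm => //.
  have sub : {subset [seq iota x | x <- enum L] <= fixed_points O q n}.
    by move=> y /mapP[x _ ->]; rewrite memK inE -rmorphXn -cardL expf_card.
  by have [] := uniq_min_size uL sub; rewrite // size_map -cardE cardL sK.
split=> //; have [uK sK memK] := fixed_points_spec cq q_gt1 (isT : 0 < 1)%N.
apply: uniq_perm => [//||y]; first by rewrite map_inj_uniq // filter_uniq // enum_uniq.
rewrite memK inE expn1; apply/idP/mapP => [/eqP yq|[x]]; last first.
  by rewrite mem_filter => /andP[/eqP xq _] ->; rewrite -rmorphXn /= xq.
have : y \in fixed_points O q n.
  by rewrite mem_fixed_points // -[n]mul1n exprq_iter_fixed ?expn1.
rewrite (perm_mem permK) => /mapP[x _ yx]; exists x => //.
by rewrite mem_filter mem_enum andbT; apply/eqP/iotaI; rewrite rmorphXn /= -yx.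
Qed.

Lemma card_subfield : #|[pred a : L | a ^+ q == a]| = q.
Proof.
have [O [iota [cq _ /perm_size]]] := finField_closure.
have [_ -> _] := fixed_points_spec cq q_gt1 (isT : 0 < 1)%N.
rewrite expn1 => qE; rewrite [RHS]qE size_map -sum1_size big_filter big_enum_cond.
by rewrite -sum1_card; apply: eq_bigl => x; rewrite inE.
Qed.

Lemma katz_bound (beta : L) (chi : L -> algC) :
  (forall k, (0 < k < n)%N -> beta ^+ (q ^ k) != beta) ->
  chi 0 = 0 -> chi 1 = 1 -> (forall x, `|chi x| <= 1) ->
  {morph chi : x y / x * y} -> \sum_x chi x = 0 ->
  `|\sum_(a | a ^+ q == a) chi (a + beta)| <= n.-1%:R * sqrtC q%:R.
Proof.
move=> beta_conj chi0 chi1 chi_le1 chiM sum_chi.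
have [O [iota [cq permK permK1]]] := finField_closure.
have iotaI : injective iota by exact: fmorph_inj.
(* The extension by 0 off the image of L is still multiplicative on F_(q^n). *)
pose chi' (y : O) := if [pick x | iota x == y] is Some x then chi x else 0.
have chiE x : chi' (iota x) = chi x.
  rewrite /chi'; case: pickP => [z /eqP /iotaI -> //|/(_ x)]; by rewrite eqxx.
have memKn y : y \in fixed_points O q n -> exists x, y = iota x.
  by rewrite (perm_mem permK) => /mapP[x _ ->]; exists x.
have -> : \sum_(a | a ^+ q == a) chi (a + beta) =
    \sum_(a <- fixed_points O q 1) chi' (a + iota beta).
  rewrite (perm_big _ permK1) /= big_map big_filter big_enum_cond /=.
  by apply: eq_bigr => a _; rewrite -rmorphD chiE.
apply: (katz_bound_closed cq q_gt1 n_gt0).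
- by rewrite -rmorphXn -cardL expf_card.
- by move=> k lek; rewrite -rmorphXn (inj_eq iotaI) beta_conj.
- by rewrite -(rmorph0 iota) chiE.
- by rewrite -(rmorph1 iota) chiE.
- by move=> x; rewrite /chi'; case: pickP => // _; rewrite normr0.
- by move=> x y /memKn[a ->] /memKn[b ->]; rewrite -rmorphM !chiE.
by rewrite (perm_big _ permK) /= big_map big_enum /= -[RHS]sum_chi; apply: eq_bigr.
Qed.

End FiniteField.

(** * Sieving over the primes dividing [m] *)

Fixpoint subset_prods (s : seq nat) : seq nat :=
  if s is p :: s' then subset_prods s' ++ [seq (p * x)%N | x <- subset_prods s']
  else [:: 1%N].

Lemma subset_prods_dvd s x : x \in subset_prods s -> (x %| \prod_(p <- s) p)%N.
Proof.
elim: s x => [|p s IHs] x /=; first by rewrite inE => /eqP ->.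
rewrite big_cons mem_cat => /orP[/IHs|/mapP[y /IHs dy ->]]; last exact: dvdn_mul.
exact: dvdn_mull.
Qed.

Lemma prod_primes_gt0 (s : seq nat) : all prime s -> (0 < \prod_(p <- s) p)%N.
Proof.
move=> /allP sp; rewrite big_seq; apply: (big_ind (fun x => 0 < x)%N) => //.
  by move=> x y; rewrite muln_gt0 => -> ->.
by move=> p /sp/prime_gt0.
Qed.

Lemma logn_prod_uniq (s : seq nat) p : uniq s -> all prime s ->
  logn p (\prod_(l <- s) l) = (p \in s).
Proof.
elim: s => [|l s IHs] /=; first by rewrite big_nil logn1.
move=> /andP[nls us] /andP[l_pr s_pr]; rewrite big_cons lognM ?(prime_gt0 l_pr) //.
  rewrite IHs // logn_prime // in_cons; case: eqVneq => [->|] //=.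
  by rewrite (negPf nls).
exact: prod_primes_gt0.
Qed.

(** The products of subsets of the primes of m are pairwise distinct square-free divisors of m. *)
Lemma card_primes_le_W m : (0 < m)%N -> (2 ^ size (primes m) <= W m)%N.
Proof.
move=> m_gt0.
have s_pr : all prime (primes m) by apply/allP => p; rewrite mem_primes => /andP[].
have us := primes_uniq m.
have size_prods s : size (subset_prods s) = (2 ^ size s)%N.
  by elim: s => //= p s IHs; rewrite size_cat size_map IHs expnS mul2n addnn.
have prods_uniq s : uniq s -> all prime s -> uniq (subset_prods s).
  elim: s => //= p s IHs /andP[nps us'] /andP[p_pr s_pr'].
  have p_gt0 := prime_gt0 p_pr.
  rewrite cat_uniq IHs // map_inj_uniq ?IHs //; last first.
    by move=> x y /eqP; rewrite eqn_pmul2l // => /eqP.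
  rewrite andbT; apply/hasPn => _ /mapP[x _ ->]; apply/negP => /subset_prods_dvd dpx.
  have : (p %| \prod_(l <- s) l)%N := dvdn_trans (dvdn_mulr _ (dvdnn p)) dpx.
  move=> dp; have : (0 < logn p (\prod_(l <- s) l))%N.
    by rewrite logn_gt0 mem_primes p_pr prod_primes_gt0.
  by rewrite logn_prod_uniq // (negPf nps).
rewrite -size_prods /W -size_filter; apply: uniq_leq_size; first exact: prods_uniq.
move=> x /subset_prods_dvd dx.
have dPm : (\prod_(l <- primes m) l %| m)%N.
  rewrite [m in (_ %| m)%N]prod_prime_decomp // prime_decompE big_map.
  rewrite big_seq [in X in (_ %| X)%N]big_seq.
  apply: (big_rec2 (fun a b => a %| b)%N) => // p a b pm dab.
  rewrite dvdn_mul //= dvdn_exp // logn_gt0 //.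
have Pgt0 := prod_primes_gt0 s_pr.
have x_gt0 := dvdn_gt0 Pgt0 dx.
rewrite mem_filter -dvdn_divisors // (dvdn_trans dx dPm) andbT.
apply/allP => p _; apply: leq_trans (dvdn_leq_log p Pgt0 dx) _.
by rewrite logn_prod_uniq // leq_b1.
Qed.

Section Sieve.
Variables (L : finFieldType) (g : L) (z : algC).
Let N := #|L|.-1.
Hypotheses (g_prim : N.-primitive_root g) (z_prim : N.-primitive_root z).
Implicit Types (x y : L) (t : nat).

(** The discrete logarithm to the base g, with the default 0 at x = 0. *)
Definition dlog x : nat := if [pick i : 'I_N | g ^+ i == x] is Some i then i else 0%N.

(** The t-th power of the character sending g to z; its value at 0 is 0 for the trivial character
    too. *)
Definition pow_char t x : algC := if x == 0 then 0 else z ^+ (t * dlog x).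

Let N_gt0 : (0 < N)%N := prim_order_gt0 g_prim.

Let nzg : g != 0.
Proof.
apply/eqP => g0; have /eqP := prim_expr_order g_prim.
by rewrite g0 expr0n gtn_eqF // mulr0n eq_sym oner_eq0.
Qed.

Lemma dlogK x : x != 0 -> g ^+ dlog x = x.
Proof.
move=> nzx; rewrite /dlog; case: pickP => [i /eqP //|none].
have xN : x ^+ N = 1.
  apply: (mulfI nzx); rewrite mulr1 -exprS prednK ?expf_card //.
  by apply/card_gt0P; exists 0.
by have [i xi] := prim_rootP g_prim xN; have := none i; rewrite xi eqxx.
Qed.

Lemma dlogP x i : x = g ^+ i -> dlog x = i %[mod N].
Proof.
move=> xi; have nzx : x != 0 by rewrite xi expf_neq0.
by apply/eqP; rewrite -(eq_prim_root_expr g_prim) dlogK // -xi.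
Qed.

Lemma zexp_mod t i j : i = j %[mod N] -> z ^+ (t * i) = z ^+ (t * j).
Proof.
by move=> ij; apply/eqP; rewrite (eq_prim_root_expr z_prim) -modnMmr ij modnMmr.
Qed.

Lemma pow_charE t x i : x = g ^+ i -> x != 0 -> pow_char t x = z ^+ (t * i).
Proof. by move=> xi nzx; rewrite /pow_char (negPf nzx) (zexp_mod _ (dlogP xi)). Qed.

Lemma pow_char0 t : pow_char t 0 = 0. Proof. by rewrite /pow_char eqxx. Qed.

Lemma pow_char1 t : pow_char t 1 = 1.
Proof. by rewrite (@pow_charE _ _ 0) ?oner_neq0 // muln0. Qed.

Lemma pow_charM t : {morph pow_char t : x y / x * y}.
Proof.
move=> x y; have [->|nzx] := eqVneq x 0; first by rewrite mul0r pow_char0 mul0r.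
have [->|nzy] := eqVneq y 0; first by rewrite mulr0 pow_char0 mulr0.
rewrite (@pow_charE _ _ (dlog x + dlog y)) ?mulf_neq0 //.
  by rewrite mulnDr exprD /pow_char (negPf nzx) (negPf nzy).
by rewrite exprD !dlogK.
Qed.

Lemma norm_pow_char_le1 t x : `|pow_char t x| <= 1.
Proof.
rewrite /pow_char; case: eqP => _; first by rewrite normr0.
have /eqP z1 : `|z| == 1.
  by rewrite -(pexpr_eq1 N_gt0) // -normrX (prim_expr_order z_prim) normr1.
by rewrite normrX z1 expr1n.
Qed.

(** Multiplication by g permutes L and multiplies the sum by chi(g) != 1. *)
Lemma sum_pow_char t : ~~ (N %| t)%N -> \sum_x pow_char t x = 0.
Proof.
move=> nNt.
have zt : pow_char t g != 1.
  rewrite (@pow_charE _ _ 1) ?expr1 // muln1 -(prim_order_dvd z_prim) //.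
have : pow_char t g * (\sum_x pow_char t x) = \sum_x pow_char t x.
  rewrite mulr_sumr [RHS](reindex (fun x => g * x)) /=; last first.
    by exists (fun x => g^-1 * x) => x _; rewrite ?mulKf ?mulVKf.
  by apply: eq_bigr => x _; rewrite pow_charM.
move/eqP; rewrite -subr_eq0 -[X in _ - X]mul1r -mulrBl mulf_eq0 subr_eq0 (negPf zt) /=.
by move/eqP.
Qed.

Lemma pow_charD t u x : pow_char (t + u) x = pow_char t x * pow_char u x.
Proof.
rewrite /pow_char; case: eqP => _; first by rewrite mul0r.
by rewrite mulnDl exprD.
Qed.

(* Orthogonality of the characters of order dividing [l]. *)
Lemma dlog_ndvdE l x : prime l -> (l %| N)%N -> x != 0 ->
  (~~ (l %| dlog x)%N)%:R =
  (1 - l%:R^-1) - l%:R^-1 * \sum_(j < l.-1) pow_char (j.+1 * (N %/ l)) x :> algC.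
Proof.
move=> l_pr lN nzx; have l_gt0 := prime_gt0 l_pr.
have nzl : l%:R != 0 :> algC by rewrite pnatr_eq0 -lt0n.
pose w := z ^+ (N %/ l * dlog x).
have wE j : pow_char (j * (N %/ l)) x = w ^+ j.
  by rewrite /pow_char (negPf nzx) /w -exprM; congr (_ ^+ _); ring.
have sumE : 1 + \sum_(j < l.-1) pow_char (j.+1 * (N %/ l)) x = \sum_(j < l) w ^+ j.
  rewrite -[in RHS](prednK l_gt0) big_ord_recl expr0; congr (_ + _).
  by apply: eq_bigr => j _; rewrite wE.
have -> : (1 - l%:R^-1) - l%:R^-1 * \sum_(j < l.-1) pow_char (j.+1 * (N %/ l)) x
   = 1 - l%:R^-1 * \sum_(j < l) w ^+ j by rewrite -sumE; ring.
have w1 : (w == 1) = (l %| dlog x)%N.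
  rewrite /w -(prim_order_dvd z_prim) -{1}(divnK lN) dvdn_pmul2l //.
  by rewrite divn_gt0 // dvdn_leq.
case: (boolP (l %| dlog x)%N) => ldv /=.
  rewrite -w1 in ldv; rewrite (eqP ldv).
  under eq_bigr do rewrite expr1n.
  by rewrite sumr_const card_ord -[1 *+ l]/(l%:R) mulVf // subrr.
suff -> : \sum_(j < l) w ^+ j = 0 by rewrite mulr0 subr0.
apply/eqP; have : (w - 1) * (\sum_(j < l) w ^+ j) = 0.
  rewrite -subrX1 /w -exprM [(_ * l)%N]mulnAC divnK // exprM (prim_expr_order z_prim).
  by rewrite expr1n subrr.
by move/eqP; rewrite mulf_eq0 subr_eq0 w1 (negPf ldv).
Qed.

Section Sums.
Variables (D : {pred L}) (E : algC) (beta : L).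
Hypotheses (nz_shift : forall a, a \in D -> a + beta != 0).
Hypothesis char_bound :
  forall t, ~~ (N %| t)%N -> `|\sum_(a in D) pow_char t (a + beta)| <= E.

(** For l dividing N, a non-zero x is an l-th power exactly when l divides [dlog x]. The product
    thus selects the a + beta that are l-th powers for no l in s, and t = 0 counts them. *)
Definition sieve_sum (s : seq nat) t : algC :=
  \sum_(a in D) pow_char t (a + beta) * \prod_(l <- s) (~~ (l %| dlog (a + beta)%R)%N)%:R.

Definition sieve_density (s : seq nat) : algC := \prod_(l <- s) (1 - l%:R^-1).

Lemma sieve_density_gt0 s : all prime s -> 0 < sieve_density s.
Proof.
move=> /allP sp; rewrite /sieve_density big_seq.
apply: (big_ind (fun x : algC => 0 < x)) => [|x y|l /sp l_pr]; first exact: ltr01.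
  exact: mulr_gt0.
by rewrite subr_gt0 invf_lt1 ?ltr0n ?prime_gt0 // ltr1n prime_gt1.
Qed.

Lemma sieve_sum_cons l s t : prime l -> (l %| N)%N ->
  sieve_sum (l :: s) t = (1 - l%:R^-1) * sieve_sum s t
    - l%:R^-1 * \sum_(j < l.-1) sieve_sum s (t + j.+1 * (N %/ l)).
Proof.
move=> l_pr lN; rewrite /sieve_sum exchange_big /= !mulr_sumr -sumrB.
apply: eq_bigr => a aD; rewrite big_cons dlog_ndvdE // ?nz_shift //.
under [X in _ = _ - _ * X]eq_bigr do rewrite pow_charD.
rewrite -mulr_suml -mulr_sumr; ring.
Qed.

(** Removing the l-th powers leaves the old sum with weight 1 - 1/l and l - 1 twisted sums with
    weight 1/l, a factor 2 (1 - 1/l) in all. The condition on t keeps every twist non-trivial. *)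
Lemma sieve_sum_char s t : uniq s -> all prime s -> all (dvdn^~ N) s ->
  ~~ (N %| t * \prod_(l <- s) l)%N ->
  `|sieve_sum s t| <= sieve_density s * (2 ^ size s)%:R * E.
Proof.
elim: s t => [|l s IHs] t.
  move=> _ _ _; rewrite big_nil muln1 => /char_bound; rewrite /sieve_density big_nil !mul1r.
  by rewrite /sieve_sum; under [in X in _ -> X]eq_bigr do rewrite big_nil mulr1.
move=> /= /andP[nls us] /andP[l_pr s_pr] /andP[lN sN]; rewrite big_cons => nNt.
have l_gt0 := prime_gt0 l_pr.
have l1_ge0 : 0 <= 1 - l%:R^-1 :> algC.
  by rewrite subr_ge0 invf_le1 ?ltr0n // ler1n.
rewrite sieve_sum_cons // /sieve_density big_cons -/(sieve_density s).
set B := sieve_density s * (2 ^ size s)%:R * E.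
have -> : (1 - l%:R^-1) * sieve_density s * (2 ^ (size s).+1)%:R * E =
    (1 - l%:R^-1) * B + l%:R^-1 * (B *+ l.-1).
  have -> : B *+ l.-1 = B * (l%:R - 1) by rewrite -[LHS]mulr_natr -subn1 natrB.
  rewrite /B expnS natrM.
  have nzl : l%:R != 0 :> algC by rewrite pnatr_eq0 -lt0n.
  by field.
apply: le_trans (ler_normB _ _) _; apply: lerD.
  rewrite normrM (ger0_norm l1_ge0) ler_wpM2l // IHs //.
  apply: contra nNt => /dvdn_trans; apply; rewrite mulnCA dvdn_mull //.
rewrite normrM ger0_norm ?invr_ge0 // ler_wpM2l ?invr_ge0 //.
apply: le_trans (ler_norm_sum _ _ _) _.
apply: (@le_trans _ _ (\sum_(j < l.-1) B)); last by rewrite sumr_const card_ord.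
apply: ler_sum => j _; apply: IHs => //.
apply: contra nNt => Nd.
(* Multiplication by l turns the twist (j + 1) N / l into a multiple of N. *)
have : (N %| l * ((t + j.+1 * (N %/ l)) * \prod_(l <- s) l))%N by rewrite dvdn_mull.
have -> : (l * ((t + j.+1 * (N %/ l)) * \prod_(l <- s) l) =
   t * (l * \prod_(l <- s) l) + j.+1 * \prod_(l <- s) l * (N %/ l * l))%N by ring.
by rewrite divnK // dvdn_addl // dvdn_mull.
Qed.

(** With k primes already treated, the trivial character brings the error factor 2^k - 1 and the
    twists, all non-trivial, bring 2^k; together 2^(k+1) - 1. *)
Lemma sieve_sum_main s : uniq s -> all prime s -> all (dvdn^~ N) s ->
  `|sieve_sum s 0 - sieve_density s * #|D|%:R|
    <= sieve_density s * ((2 ^ size s)%:R - 1) * E.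
Proof.
elim: s => [|l s IHs].
  move=> _ _ _; rewrite expn0 subrr mulr0 mul0r /sieve_density big_nil mul1r.
  rewrite /sieve_sum (eq_bigr (fun=> 1)) => [|a aD]; last first.
    by rewrite big_nil mulr1 /pow_char (negPf (nz_shift aD)) mul0n.
  by rewrite sumr_const subrr normr0.
move=> /= /andP[nls us] /andP[l_pr s_pr] /andP[lN sN].
have l_gt0 := prime_gt0 l_pr.
have l1_ge0 : 0 <= 1 - l%:R^-1 :> algC.
  by rewrite subr_ge0 invf_le1 ?ltr0n // ler1n.
rewrite sieve_sum_cons // /sieve_density big_cons -/(sieve_density s).
set B := sieve_density s * (2 ^ size s)%:R * E.
set B' := sieve_density s * ((2 ^ size s)%:R - 1) * E.
have -> : (1 - l%:R^-1) * sieve_density s * ((2 ^ (size s).+1)%:R - 1) * E =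
    (1 - l%:R^-1) * B' + l%:R^-1 * (B *+ l.-1).
  have -> : B *+ l.-1 = B * (l%:R - 1) by rewrite -[LHS]mulr_natr -subn1 natrB.
  rewrite /B /B' expnS natrM.
  have nzl : l%:R != 0 :> algC by rewrite pnatr_eq0 -lt0n.
  by field.
rewrite addrAC -mulrA -mulrBr.
apply: le_trans (ler_normB _ _) _; apply: lerD.
  by rewrite normrM (ger0_norm l1_ge0) ler_wpM2l // IHs.
rewrite normrM ger0_norm ?invr_ge0 // ler_wpM2l ?invr_ge0 //.
apply: le_trans (ler_norm_sum _ _ _) _.
apply: (@le_trans _ _ (\sum_(j < l.-1) B)); last by rewrite sumr_const card_ord.
apply: ler_sum => j _.
(* The prime l divides neither j + 1 < l nor the product of the other primes. *)
apply: sieve_sum_char => //; rewrite add0n -mulnA.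
have N_l : (0 < N %/ l)%N by rewrite divn_gt0 // dvdn_leq.
rewrite mulnCA -{1}(divnK lN) dvdn_pmul2l // Euclid_dvdM // negb_or.
rewrite gtnNdvd //=; last by rewrite -ltn_predRL ltn_ord.
apply/negP => ld; have : (0 < logn l (\prod_(l <- s) l))%N.
  by rewrite logn_gt0 mem_primes l_pr prod_primes_gt0.
by rewrite logn_prod_uniq // (negPf nls).
Qed.

End Sums.
End Sieve.

(** * Existence of an m-free translate *)

Theorem theorem7p3 (L : finFieldType) (q n m : nat) (beta : L) :
  (exists p k : nat, [/\ prime p, (0 < k)%N & q = (p ^ k)%N]) ->
  (4 <= n)%N ->
  #|L| = (q ^ n)%N ->
  (0 < m)%N -> (m %| (q ^ n).-1)%N ->
  k_normal q n 2 beta ->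
  (forall d : nat, (d %| n)%N -> (d < n)%N -> beta ^+ (q ^ d) != beta) ->
  ((n.-1 * W m) ^ 2 <= q)%N ->
  (0 < N_beta q beta m)%N.
Proof.
move=> [p [e [p_pr e_gt0 qE]]] n_ge4 cardL m_gt0 m_dvd _ beta_gen qW; subst q.
set q := (p ^ e)%N in cardL m_dvd beta_gen qW *.
have n_gt0 : (0 < n)%N by apply: leq_trans n_ge4.
have q_gt1 : (1 < q)%N by rewrite -(exp1n e) ltn_exp2r ?prime_gt1.
have beta_fixed : beta ^+ (q ^ n) = beta by rewrite -cardL expf_card.
have beta_conj k : (0 < k < n)%N -> beta ^+ (q ^ k) != beta.
  move=> /andP[k_gt0 ltkn]; apply/eqP => bk.
  (* As gcd(k, n) is a proper divisor of n, [beta] would lie in a proper subfield. *)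
  have := exprq_gcdn_fixed k_gt0 bk beta_fixed.
  apply/eqP/beta_gen; first exact: dvdn_gcdr.
  by apply: leq_ltn_trans ltkn; rewrite dvdn_leq ?dvdn_gcdl.
pose N := #|L|.-1.
have N_gt0 : (0 < N)%N by rewrite -ltnS prednK ?finNzRing_gt1 // ltnW ?finNzRing_gt1.
have /hasP[g _ g_prim] : has N.-primitive_root [seq x <- enum L | x != 0].
  apply: has_prim_root => //; last 2 first.
  - by rewrite filter_uniq ?enum_uniq.
  - have := cardC1 (0 : L); rewrite -/N => <-; rewrite cardE.
    apply: uniq_leq_size; first exact: enum_uniq.
    by move=> x; rewrite mem_enum mem_filter mem_enum andbT.
  apply/allP => x; rewrite mem_filter => /andP[nzx _]; rewrite unity_rootE.
  apply/eqP/(mulfI nzx); rewrite mulr1 -exprS prednK ?expf_card //.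
  by rewrite ltnW ?finNzRing_gt1.
have [z z_prim] := C_prim_root_exists N_gt0.
pose D : {pred L} := [pred a | a ^+ q == a].
pose E : algC := n.-1%:R * sqrtC q%:R.
(* Otherwise [beta] = -a would lie in F_q. *)
have nz_shift a : a \in D -> a + beta != 0.
  rewrite inE => /eqP aq; apply/eqP => ab; have /eqP[] : beta ^+ (q ^ 1) != beta.
    by apply: beta_conj; apply: leq_trans n_ge4.
  have cL : p \in [pchar L] by apply: (card_finPcharP (n := (e * n)%N)); rewrite // expnM.
  have cq : [pchar L].-nat q by rewrite (eq_pnat _ (pcharf_eq cL)) pnatX pnat_id.
  have -> : beta = 0 - a by apply/eqP; rewrite sub0r -addr_eq0 addrC ab.
  by rewrite expn1 exprBn_frobenius // aq expr0n gtn_eqF // ltnW.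
have char_bound t : ~~ (N %| t)%N -> `|\sum_(a in D) pow_char g z t (a + beta)| <= E.
  move=> nNt; apply: (katz_bound p_pr e_gt0 n_gt0 cardL beta_conj).
  - exact: pow_char0.
  - exact: pow_char1.
  - exact: norm_pow_char_le1.
  - exact: pow_charM.
  exact: sum_pow_char.
have mN l : l \in primes m -> (l %| N)%N.
  by rewrite mem_primes => /and3P[_ _ lm]; rewrite (dvdn_trans lm) // /N cardL.
have s_pr : all prime (primes m) by apply/allP => l; rewrite mem_primes => /andP[].
have sN : all (dvdn^~ N) (primes m) by apply/allP.
have := sieve_sum_main g_prim z_prim nz_shift char_bound (primes_uniq m) s_pr sN.
rewrite (card_subfield p_pr e_gt0 n_gt0 cardL) -/q.
case: (posnP (N_beta q beta m)) => // /eqP; rewrite cards_eq0 => /eqP no_free.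
(* If no translate is m-free, each a + beta is a d-th power for some d > 1 dividing m, hence an l-th
   power for a prime l dividing m, and its summand vanishes. *)
have -> : sieve_sum g z D beta (primes m) 0 = 0.
  rewrite /sieve_sum big1 // => a aD; have nza := nz_shift a aD.
  have : a \notin [set a | (a ^+ q == a) && m_free m (a + beta)] by rewrite no_free inE.
  rewrite inE; move: aD; rewrite inE => -> /=; rewrite /m_free nza /= => /forallPn[d].
  move=> /forallPn[eta]; rewrite negb_imply => /andP[/andP[/andP[d_gt0 dm] /eqP aE] d_neq1].
  have [l_pr ld] : prime (pdiv d) /\ (pdiv d %| d)%N.
    by rewrite pdiv_dvd pdiv_prime // ltn_neqAle eq_sym d_neq1.
  have lm : pdiv d \in primes m by rewrite mem_primes l_pr m_gt0 (dvdn_trans ld dm).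
  have nzeta : eta != 0.
    by apply: contraNneq nza => eta0; rewrite aE eta0 expr0n gtn_eqF.
  have ldlog : (pdiv d %| dlog g (a + beta)%R)%N.
    have ax : a + beta = g ^+ (dlog g eta * d) by rewrite aE exprM dlogK.
    have := dlogP g_prim ax; rewrite -/N => E'.
    rewrite /dvdn -(modn_dvdm _ (mN _ lm)) E' modn_dvdm ?mN // -/(dvdn _ _).
    by rewrite dvdn_mull.
  by rewrite (big_rem _ lm) /= ldlog mul0r mulr0.
set th := sieve_density (primes m); have th_gt0 : 0 < th by apply: sieve_density_gt0.
have q_ge0 : 0 <= q%:R :> algC by [].
(* After cancelling the density and sqrt q, the sieve gives sqrt q <= (2^k - 1) (n - 1) with k the
   number of primes of m. Together with (n - 1) W(m) <= sqrt q this yields W(m) < 2^k, a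
   contradiction. *)
rewrite sub0r normrN ger0_norm ?mulr_ge0 ?(ltW th_gt0) // -mulrA ler_pM2l //.
have Wle := card_primes_le_W m_gt0.
pose r : algC := sqrtC q%:R; have r_gt0 : 0 < r by rewrite sqrtC_gt0 ltr0n ltnW.
rewrite -(sqrtCK q%:R) -/r expr2 /E -/r mulrA ler_pM2r // => le_r.
have : ((n.-1 * W m)%N%:R : algC) <= r.
  rewrite -(ler_pXn2r (_ : 0 < 2)%N) ?nnegrE ?(ltW r_gt0) //.
  by rewrite sqrtCK -natrX ler_nat.
move/le_trans => /(_ _ le_r); rewrite mulrC natrM.
have n1_gt0 : 0 < n.-1%:R :> algC by rewrite ltr0n; case: (n) n_ge4 => [|[]].
rewrite ler_pM2l // lerBrDr natr1 ler_nat => le_W.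
by rewrite ltnNge Wle in le_W.
Qed.
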